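(* For all positive real numbers $l_1, l_2, c, \xi$, there exists at least one minimiser $(Q_{11}^*, Q_{12}^*, M_1^*, M_2^* )$ of the ferronematic free energy $F$ in the admissible space $\mathcal{A}$. Moreover, this minimiser is a classical solution of the Euler--Lagrange system $$l_1 Q_{11}'' = 4 Q_{11}(Q_{11}^2 + Q_{12}^2 - 1) - c\left(M_1^2 - M_2^2 \right),$$ $$l_1 Q_{12}'' = 4 Q_{12}(Q_{11}^2 + Q_{12}^2 - 1) - 2cM_1 M_2,$$ $$\xi l_2 M_1'' = \xi M_1 \left(M_1^2 + M_2^2 - 1 \right) - 2c Q_{11}M_1 - 2c Q_{12}M_2,$$ $$\xi l_2 M_2'' = \xi M_2 \left(M_1^2 + M_2^2 - 1 \right) + 2c Q_{11} M_2 - 2c Q_{12} M_1$$ on $(-1,1)$, subject to the boundary conditions $Q_{11}(-1)=M_1(-1)=1$, $Q_{11}(1)=M_1(1)=-1$, $Q_{12}(\pm1)=M_2(\pm1)=0$.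
   Context: Let $\Omega=[-1,1]$ and let $'$ denote $\frac{\mathrm{d}}{\mathrm{d}y}$. A symmetric traceless $2\times2$ matrix $\mathbf{Q}$ is identified with its two independent components $(Q_{11},Q_{12})$, and $\mathbf{M}=(M_1,M_2)\in\mathbb{R}^2$. The admissible space $\mathcal{A}$ is the set of all $(Q_{11},Q_{12},M_1,M_2)$ with every component in $W^{1,2}(\Omega;\mathbb{R})$ satisfying the boundary conditions $Q_{11}(-1)=M_1(-1)=1$, $Q_{11}(1)=M_1(1)=-1$, $Q_{12}(-1)=Q_{12}(1)=M_2(-1)=M_2(1)=0$. The ferronematic free energy is $$F(Q_{11}, Q_{12}, M_1, M_2) = \int_{-1}^{1} \Big\{\tfrac{l_1}{2}\left[(Q_{11}')^2 + (Q_{12}')^2 \right] + \left( Q_{11}^2 + Q_{12}^2 - 1 \right)^2 + \tfrac{\xi l_2}{2} \left[ (M_1')^2 + (M_2')^2 \right] + \tfrac{\xi}{4}\left(M_1^2 + M_2^2 - 1 \right)^2 - cQ_{11}\left(M_1^2 - M_2^2 \right) - 2c Q_{12}M_1 M_2 \Big\}\,\mathrm{d}y.$$ *)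

(* Defs.v *)
From HB Require Import structures.
From mathcomp Require Import all_boot all_order all_algebra.
From mathcomp Require Import all_classical all_reals all_analysis.

Set Implicit Arguments.
Unset Strict Implicit.
Unset Printing Implicit Defensive.

Import Order.TTheory GRing.Theory Num.Theory.
Import numFieldNormedType.Exports.

Local Open Scope classical_set_scope.
Local Open Scope ring_scope.

(* ring_scope reserves these notations for formal derivatives of polynomials. *)
Local Notation "f ^` ()" := (derive1 f) : ring_scope.
Local Notation "f ^` ( n )" := (derive1n n f) : ring_scope.

Definition Omega (R : realType) : set R := `[-1, 1]%classic.
Arguments Omega R : clear implicits.

(* C_c^oo(-1, 1), with functions extended by zero to R.  The support is a
   closed subset of the bounded interval ]-1, 1[, hence compact. *)
Definition test_function (R : realType) (phi : R -> R) : Prop :=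
  (forall (n : nat) (y : R), derivable phi^`(n) y 1) /\
  closure [set y | phi y != 0] `<=` `]-1, 1[%classic.

(* Functions are total on R; only their values on Omega matter. *)
Definition square_integrable (R : realType) (f : R -> R) : Prop :=
  measurable_fun (Omega R) f /\
  (@lebesgue_measure R).-integrable (Omega R) (fun y => (f y ^+ 2)%:E).

Definition is_weak_derivative (R : realType) (u g : R -> R) : Prop :=
  forall phi : R -> R, test_function phi ->
    \int[@lebesgue_measure R]_(y in Omega R) (u y * phi^`() y) =
    - \int[@lebesgue_measure R]_(y in Omega R) (g y * phi y).

Definition W12 (R : realType) (u : R -> R) : Prop :=
  square_integrable u /\
  exists g : R -> R, square_integrable g /\ is_weak_derivative u g.

(* A chosen L^2 weak derivative of u (0 if there is none); for u in W12 it is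
   unique up to a Lebesgue-null subset of Omega. *)
Definition weak_derivative (R : realType) (u : R -> R) : R -> R :=
  xget (fun=> 0) [set g | square_integrable g /\ is_weak_derivative u g].

(* Every class in W^{1,2}(Omega) has exactly one representative continuous on
   Omega; the boundary values are the endpoint values of that one, so elements
   of the admissible space are given by their continuous representatives. *)
Definition W12_continuous (R : realType) (u : R -> R) : Prop :=
  W12 u /\ {within Omega R, continuous u}.

Definition boundary_conditions (R : realType) (Q11 Q12 M1 M2 : R -> R) : Prop :=
  [/\ Q11 (-1) = 1 /\ M1 (-1) = 1,
      Q11 1 = -1 /\ M1 1 = -1,
      Q12 (-1) = 0 /\ Q12 1 = 0
    & M2 (-1) = 0 /\ M2 1 = 0].

Definition admissible (R : realType) (Q11 Q12 M1 M2 : R -> R) : Prop :=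
  [/\ W12_continuous Q11, W12_continuous Q12,
      W12_continuous M1, W12_continuous M2
    & boundary_conditions Q11 Q12 M1 M2].

(* On admissible arguments the integrand is Lebesgue integrable, so that the
   real-valued integral is the genuine one. *)
Definition energy (R : realType) (l1 l2 c xi : R) (Q11 Q12 M1 M2 : R -> R) : R :=
  \int[@lebesgue_measure R]_(y in Omega R)
    (l1 / 2 * (weak_derivative Q11 y ^+ 2 + weak_derivative Q12 y ^+ 2)
     + (Q11 y ^+ 2 + Q12 y ^+ 2 - 1) ^+ 2
     + xi * l2 / 2 * (weak_derivative M1 y ^+ 2 + weak_derivative M2 y ^+ 2)
     + xi / 4 * (M1 y ^+ 2 + M2 y ^+ 2 - 1) ^+ 2
     - c * Q11 y * (M1 y ^+ 2 - M2 y ^+ 2)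
     - 2 * c * Q12 y * M1 y * M2 y).

Definition minimiser (R : realType) (l1 l2 c xi : R)
    (Q11 Q12 M1 M2 : R -> R) : Prop :=
  admissible Q11 Q12 M1 M2 /\
  forall P11 P12 N1 N2 : R -> R, admissible P11 P12 N1 N2 ->
    energy l1 l2 c xi Q11 Q12 M1 M2 <= energy l1 l2 c xi P11 P12 N1 N2.

(* C^2(-1, 1) with continuity up to the boundary *)
Definition C2_interior (R : realType) (u : R -> R) : Prop :=
  {within Omega R, continuous u} /\
  forall y : R, -1 < y < 1 ->
    [/\ derivable u y 1, derivable u^`() y 1 & {for y, continuous u^`(2)}].

Definition Euler_Lagrange (R : realType) (l1 l2 c xi : R)
    (Q11 Q12 M1 M2 : R -> R) (y : R) : Prop :=
  [/\ l1 * Q11^`(2) y =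
        4 * Q11 y * (Q11 y ^+ 2 + Q12 y ^+ 2 - 1)
        - c * (M1 y ^+ 2 - M2 y ^+ 2),
      l1 * Q12^`(2) y =
        4 * Q12 y * (Q11 y ^+ 2 + Q12 y ^+ 2 - 1) - 2 * c * M1 y * M2 y,
      xi * l2 * M1^`(2) y =
        xi * M1 y * (M1 y ^+ 2 + M2 y ^+ 2 - 1)
        - 2 * c * Q11 y * M1 y - 2 * c * Q12 y * M2 y
    & xi * l2 * M2^`(2) y =
        xi * M2 y * (M1 y ^+ 2 + M2 y ^+ 2 - 1)
        + 2 * c * Q11 y * M2 y - 2 * c * Q12 y * M1 y].

Definition classical_solution (R : realType) (l1 l2 c xi : R)
    (Q11 Q12 M1 M2 : R -> R) : Prop :=
  [/\ [/\ C2_interior Q11, C2_interior Q12, C2_interior M1 & C2_interior M2],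
      forall y : R, -1 < y < 1 -> Euler_Lagrange l1 l2 c xi Q11 Q12 M1 M2 y
    & boundary_conditions Q11 Q12 M1 M2].

(* Main.v *)
(* Write the energy as the integral of [sum_k al_k / 2 |u_k'|^2 + f(u)].  On the
   uniform grid of mesh [h = 2 / N] the discretised energy has a minimiser, and
   its difference quotients [v] satisfy a discrete Euler-Lagrange equation
   [v_(i+1) - v_i = h df(u_(i+1)) / al].  Bounds on [u] and [v] uniform in [N]
   follow from the energy bound.  The interpolated sequences are passed to the
   limit pointwise along one free ultrafilter on [nat], so that no subsequence
   and no uniform convergence is needed: the discrete second-order estimates
   [|u(y) - u(x) - (y - x) v(x)| <= C (y - x)^2] survive the limit and say that
   [u' = v], that [v' = df(u) / al], and that the limit [e] of the partial
   energies has derivative the energy density, so [e 1] is the energy of [u].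
   Conversely the discrete energy of the grid values of any admissible [w] is
   at most the energy of [w] up to [o(1)], because [(w_(i+1) - w_i)^2 / h] is at
   most the integral of [g^2] over the cell when [g] is the weak derivative of
   [w].  This uses [w(b) - w(a) = \int_a^b g], obtained by testing against
   smooth plateau functions converging to the indicator function
   of ]a, b]. *)

Require Import Defs.
From mathcomp Require Import all_boot all_order all_algebra.
From mathcomp Require Import all_classical all_reals all_analysis.
From mathcomp Require Import measurable_realfun ring lra.

Set Implicit Arguments.
Unset Strict Implicit.
Unset Printing Implicit Defensive.

Import Order.TTheory GRing.Theory Num.Theory.
Import numFieldNormedType.Exports.

Local Open Scope classical_set_scope.
Local Open Scope ring_scope.

Local Notation "f ^` ()" := (derive1 f) : ring_scope.
Local Notation "f ^` ( n )" := (derive1n n f) : ring_scope.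

(** * Limits along an ultrafilter and locally Lipschitz functions *)

(** A fixed ultrafilter refining [\oo]. Every bounded sequence converges along it, so a single
    choice serves all components and all points at once. *)
Definition ultraN : set_system nat :=
  projT1 (cid (ultraFilterLemma (F := \oo) _)).

#[global] Instance ultraN_ultra : UltraFilter ultraN.
Proof. by rewrite /ultraN; case: cid => ? []. Qed.

Lemma ultraN_oo : \oo `<=` ultraN.
Proof. by rewrite /ultraN; case: cid => ? []. Qed.

Section Ultralimit.
Context {R : realType}.
Implicit Types (s t : nat -> R) (B : R).

Definition ulim s : R := lim (s @ ultraN).

(** Compactness of the segment gives a cluster point. Along an ultrafilter a cluster point is a
    limit: a neighbourhood or its complement is large, and a large complement would have to meet the
    neighbourhood. *)
Lemma ulimP s B : (forall n, `|s n| <= B) -> s @ ultraN --> ulim s.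
Proof.
move=> sB; apply/cvg_ex.
have [|p [_ pcl]] := @segment_compact R (- B) B (s @ ultraN) _.
  suff : ultraN (s @^-1` `[- B, B]) by [].
  by apply: filterE => n; rewrite /= in_itv /= -ler_norml.
exists p => A pA.
have [//|UnA] := in_ultra_setVsetC (s @^-1` A) ultraN_ultra.
have [|x [nAx Ax]] := pcl (~` A) A _ pA; first exact: UnA.
by case: nAx.
Qed.

Lemma ulimE s l : s @ ultraN --> l -> ulim s = l.
Proof. by move=> sl; apply: cvg_lim. Qed.

Lemma ulim_cst (c : R) : ulim (fun=> c) = c.
Proof. by apply: ulimE; apply: cvg_cst. Qed.

End Ultralimit.

Lemma cvg_bigsum {R : realType} {T : Type} {J : eqType} (F : set_system T)
    {FF : Filter F} (r : seq J) (g : J -> T -> R) (l : J -> R) :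
  (forall j, j \in r -> g j t @[t --> F] --> l j) ->
  \sum_(j <- r) g j t @[t --> F] --> \sum_(j <- r) l j.
Proof.
move=> gl; under eq_fun do rewrite big_seq.
by rewrite big_seq; apply: cvg_big => //; exact: add_continuous.
Qed.

Section LocallyLipschitz.
Context {R : realType} {I : finType}.
Implicit Types (g : (I -> R) -> R) (x y : I -> R).

(** Lipschitz on every cube, for the sum norm. The class contains all polynomials in the coordinates
    and yields both continuity and boundedness on cubes. *)
Definition loclip g := forall B : R, exists2 C : R, 0 <= C &
  forall x y, (forall k, `|x k| <= B) -> (forall k, `|y k| <= B) ->
    `|g x - g y| <= C * \sum_k `|x k - y k|.

Lemma loclip_bounded g B : loclip g ->
  exists2 C : R, 0 <= C & forall x, (forall k, `|x k| <= B) -> `|g x| <= C.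
Proof.
move=> /(_ `|B|) [C C0 gC].
exists (`|g (fun=> 0)| + C * \sum_(k : I) `|B|).
  by rewrite addr_ge0// mulr_ge0// sumr_ge0.
move=> x xB; rewrite -[g x](subrK (g (fun=> 0))) (le_trans (ler_normD _ _))//.
rewrite addrC lerD2l.
have xB' k : `|x k| <= `|B| by rewrite (le_trans (xB k))// ler_norm.
apply: (le_trans (gC x (fun=> 0) xB' _)) => [k|]; first by rewrite normr0.
by rewrite ler_wpM2l// ler_sum// => k _; rewrite subr0.
Qed.

Lemma loclip_cst (c : R) : loclip (fun=> c).
Proof. by move=> B; exists 0 => // x y _ _; rewrite subrr normr0 mul0r. Qed.

Lemma loclip_proj (k : I) : loclip (fun x => x k).
Proof.
move=> B; exists 1 => // x y _ _; rewrite mul1r (bigD1 k)//= lerDl.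
by rewrite sumr_ge0.
Qed.

Lemma loclipD g1 g2 : loclip g1 -> loclip g2 -> loclip (fun x => g1 x + g2 x).
Proof.
move=> h1 h2 B; have [C1 C10 g1C] := h1 B; have [C2 C20 g2C] := h2 B.
exists (C1 + C2) => [|x y xB yB]; first by rewrite addr_ge0.
rewrite opprD addrACA (le_trans (ler_normD _ _))// mulrDl lerD//.
- exact: g1C.
- exact: g2C.
Qed.

Lemma loclipM g1 g2 : loclip g1 -> loclip g2 -> loclip (fun x => g1 x * g2 x).
Proof.
move=> h1 h2 B; have [C1 C10 g1C] := h1 B; have [C2 C20 g2C] := h2 B.
have [D1 D10 g1D] := loclip_bounded B h1.
have [D2 D20 g2D] := loclip_bounded B h2.
exists (D2 * C1 + D1 * C2) => [|x y xB yB]; first by rewrite addr_ge0// mulr_ge0.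
have -> : g1 x * g2 x - g1 y * g2 y = g2 x * (g1 x - g1 y) + g1 y * (g2 x - g2 y).
  by ring.
rewrite (le_trans (ler_normD _ _))// !normrM mulrDl -!mulrA lerD//.
- by rewrite ler_pM// ?g2D ?g1C.
- by rewrite ler_pM// ?g1D ?g2C.
Qed.

Lemma loclipN g : loclip g -> loclip (fun x => - g x).
Proof.
move=> hg; have -> : (fun x => - g x) = (fun x => -1 * g x).
  by apply/funext => x; rewrite mulN1r.
exact: loclipM (loclip_cst _) hg.
Qed.

Lemma loclipX g n : loclip g -> loclip (fun x => g x ^+ n).
Proof.
move=> hg; elim: n => [|n IHn]; first exact: loclip_cst.
under eq_fun do rewrite exprS; exact: loclipM.
Qed.

Lemma loclip_cvg {T : Type} (F : set_system T) {FF : Filter F} g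
    (s : T -> I -> R) x : loclip g ->
  (forall k, s t k @[t --> F] --> x k) -> g (s t) @[t --> F] --> g x.
Proof.
(* The margin 1 in each coordinate keeps [s t] eventually in the cube of size [B], where one
   Lipschitz constant applies. *)
move=> hg sx; pose B := \sum_k (`|x k| + 1).
have xB k : `|x k| + 1 <= B.
  by rewrite /B (bigD1 k)//= lerDl sumr_ge0// => j _; rewrite addr_ge0.
have [C C0 gC] := hg B.
have gs : `|g (s t) - g x| @[t --> F] --> (0 : R).
  apply: (@squeeze_cvgr _ F _ R (fun=> 0) (fun t => C * \sum_k `|s t k - x k|)).
  - near=> t; rewrite normr_ge0/=; apply: gC => k; last first.
      by rewrite (le_trans _ (xB k))// lerDl.
    suff : forall k, `|s t k| <= B by exact.
    near: t; apply: filter_forall => j; near=> t; apply: le_trans (xB j).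
    near: t; apply: (cvgr_norm_le (x j)); [exact: sx|by rewrite ltrDl ltr01].
  - exact: cvg_cst.
  have xs : \sum_k `|s t k - x k| @[t --> F] --> \sum_(k : I) (0 : R).
    apply: cvg_bigsum => k _; have /subr_cvg0/cvg_norm := sx k.
    by rewrite normr0.
  by have := cvgM (cvg_cst C) xs; rewrite big1// mulr0; apply.
by apply/subr_cvg0; exact: norm_cvg0 gs.
Unshelve. all: by end_near. Qed.

End LocallyLipschitz.
(** * The discretised problem *)

Section DiscreteProblem.
Context {R : realType} {I : finType}.
Variables (al : I -> R) (f : (I -> R) -> R) (df : I -> (I -> R) -> R) (K : R).
Hypothesis al_gt0 : forall k, 0 < al k.
Hypothesis f_ge : forall x, - K <= f x.
Hypothesis f_lip : loclip f.
(** A one-sided second-order bound in one coordinate: an upper bound on the energy of competitors is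
    enough to extract stationarity of a minimiser. *)
Hypothesis f_der : forall x k, exists C : R, forall t, `|t| <= 1 ->
  f (fun j => if j == k then x j + t else x j) <= f x + t * df k x + C * t ^+ 2.

Definition mesh (N : nat) : R := 2 / N%:R.

(** The gradient part is exact for the affine interpolant of [p] and [q] on a cell of length [h];
    the potential is sampled at the left node. *)
Definition denergy_cell (h : R) (p q : I -> R) : R :=
  (\sum_k al k * (q k - p k) ^+ 2) / (2 * h) + h * f p.

Definition denergy (N : nat) (x : nat -> I -> R) : R :=
  \sum_(0 <= i < N) denergy_cell (mesh N) (x i) (x i.+1).

Lemma mesh_gt0 N : (0 < N)%N -> 0 < mesh N.
Proof. by move=> N0; rewrite divr_gt0// ltr0n. Qed.

Lemma mulr_mesh N : (0 < N)%N -> N%:R * mesh N = 2.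
Proof. by move=> N0; rewrite mulrC divfK// pnatr_eq0 -lt0n. Qed.

Lemma sumr_mesh N (c : R) : (0 < N)%N -> \sum_(0 <= i < N) (mesh N * c) = 2 * c.
Proof.
by move=> N0; rewrite sumr_const_nat subn0 -[LHS]mulr_natl mulrA mulr_mesh.
Qed.

(* [|d| <= h / 2 + d^2 / (2 h)] bounds the total variation by the energy. *)
Lemma denergy_bounded N x C i k : (0 < N)%N -> denergy N x <= C -> (i <= N)%N ->
  `|x i k - x 0%N k| <= 1 + (C + 2 * K) / al k.
Proof.
move=> N0 xC iN; set h := mesh N.
have h0 : 0 < h by exact: mesh_gt0.
rewrite -(telescope_sumr (fun j => x j k))// (le_trans (ler_norm_sum _ _ _))//.
apply: (@le_trans _ _ (\sum_(0 <= j < N) (h * 2^-1 +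
    (x j.+1 k - x j k) ^+ 2 / (2 * h)))).
  rewrite [leRHS](@big_cat_nat _ _ _ i)//=.
  rewrite -[leLHS]addr0 lerD//; last first.
    have hge0 := ltW h0; rewrite sumr_ge0// => j _.
    by apply: addr_ge0; apply: divr_ge0; rewrite ?sqr_ge0 ?mulr_ge0.
  apply: ler_sum => j _; set d := x j.+1 k - x j k.
  have -> : h * 2^-1 + d ^+ 2 / (2 * h) = `|d| + (`|d| - h) ^+ 2 / (2 * h).
    by rewrite -(real_normK (num_real d)); field; rewrite gt_eqF.
  by rewrite lerDl divr_ge0 ?sqr_ge0// mulr_ge0// ltW.
rewrite big_split/= sumr_mesh// mulfV// lerD2l.
rewrite ler_pdivlMr// mulrC mulr_sumr.
(* The potential part of the energy is at least [- 2 K], so the gradient part is at most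
   [C + 2 K]. *)
have fK : \sum_(0 <= j < N) (h * f (x j)) >= - (2 * K).
  by rewrite -mulrN -(sumr_mesh _ N0) ler_sum// => j _; rewrite ler_pM2l.
move: xC; rewrite /denergy big_split/= => xC.
apply: (@le_trans _ _ (\sum_(0 <= j < N)
    (\sum_k0 al k0 * (x j.+1 k0 - x j k0) ^+ 2) / (2 * h))); last first.
  rewrite -/h in xC; lra.
apply: ler_sum => j _; rewrite mulrA ler_wpM2r//.
  by rewrite invr_ge0 mulr_ge0// ltW.
rewrite (bigD1 k)//= lerDl sumr_ge0// => m _.
by rewrite mulr_ge0 ?sqr_ge0// ltW.
Qed.

Definition affine_path (N : nat) (a b : I -> R) (i : nat) (k : I) : R :=
  a k + (i%:R / N%:R) * (b k - a k).

Lemma affine_path0 N a b : affine_path N a b 0%N = a.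
Proof. by apply/funext => k; rewrite /affine_path mul0r mul0r addr0. Qed.

Lemma affine_pathN N a b : (0 < N)%N -> affine_path N a b N = b.
Proof.
move=> N0; apply/funext => k.
by rewrite /affine_path divff ?pnatr_eq0 -?lt0n// mul1r addrC subrK.
Qed.

(** The affine path has gradient energy [D / 4] on every grid and stays in a cube independent of
    [N]. As a competitor it bounds the minimal energies uniformly in [N]. *)
Lemma denergy_affine_path (a b : I -> R) : exists C : R, forall N, (0 < N)%N ->
  denergy N (affine_path N a b) <= C.
Proof.
pose B := \sum_k (`|a k| + `|b k - a k|).
have [C C0 fC] := loclip_bounded B f_lip.
pose D := \sum_k al k * (b k - a k) ^+ 2.
exists (2 * (D / 8 + C)) => N N0.
rewrite -(sumr_mesh _ N0) /denergy; apply: ler_sum_nat => i /andP[_ iN].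
have h0 := mesh_gt0 N0.
have Nr : (N%:R : R) != 0 by rewrite pnatr_eq0 -lt0n.
rewrite /denergy_cell mulrDr lerD//.
- have -> : \sum_k al k * (affine_path N a b i.+1 k - affine_path N a b i k) ^+ 2
    = D / N%:R ^+ 2.
    rewrite mulr_suml; apply: eq_bigr => k _; rewrite /affine_path -natr1.
    by field.
  by rewrite /mesh le_eqVlt; apply/orP; left; apply/eqP; field.
- rewrite ler_pM2l// (le_trans (ler_norm _))// fC// => k.
  rewrite /B (bigD1 k)//= -[leLHS]addr0; apply: lerD; last first.
    by rewrite sumr_ge0// => j _; rewrite addr_ge0.
  rewrite (le_trans (ler_normD _ _))// lerD2l normrM -[leRHS]mul1r ler_wpM2r//.
  by rewrite ger0_norm// ler_pdivrMr ?ltr0n// mul1r ler_nat ltnW.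
Qed.

(** Direct method in finite dimension: a minimising sequence is bounded at each node by
    [denergy_bounded], and the discrete energy is continuous along its ultralimit. *)
Lemma denergy_minimiser N a b : (0 < N)%N -> exists x : nat -> I -> R,
  [/\ x 0%N = a, x N = b & forall y : nat -> I -> R,
    y 0%N = a -> y N = b -> denergy N x <= denergy N y].
Proof.
move=> N0.
pose E := [set denergy N y | y in [set y | y 0%N = a /\ y N = b]].
have Einf : has_inf E.
  split.
    exists (denergy N (affine_path N a b)); exists (affine_path N a b) => //=.
    by rewrite affine_path0 affine_pathN.
  exists (- (2 * K)) => _ [y _ <-]; rewrite -mulrN -(sumr_mesh _ N0).
  apply: ler_sum => i _; rewrite /denergy_cell -[leLHS]add0r lerD//.
    rewrite divr_ge0 ?mulr_ge0 ?(ltW (mesh_gt0 N0))//.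
    by rewrite sumr_ge0// => k _; rewrite mulr_ge0 ?sqr_ge0// ltW.
  by rewrite ler_pM2l// mesh_gt0.
have /choice[y yP] n : exists y : nat -> I -> R,
    [/\ y 0%N = a, y N = b & denergy N y < inf E + n.+1%:R^-1].
  have n0 : 0 < (n.+1%:R^-1 : R) by rewrite invr_gt0 ltr0n.
  by have [_ [y [y0 yN] <-] yE] := inf_adherent n0 Einf; exists y.
(* The bound of [denergy_bounded] for paths of energy at most [inf E + 1]. *)
pose B k : R := `|a k| + (1 + (inf E + 1 + 2 * K) / al k).
have yB n i k : (i <= N)%N -> `|y n i k| <= B k.
  move=> iN; have [yn0 _ yE] := yP n.
  rewrite -[y n i k](subrK (a k)) (le_trans (ler_normD _ _))// addrC lerD2l.
  rewrite -yn0; apply: denergy_bounded iN => //; rewrite (le_trans (ltW yE))//.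
  by rewrite lerD2l invf_le1// ?ler1n ?ltr0n.
pose x i k := ulim (fun n => y n i k).
have yx i k : (i <= N)%N -> y n i k @[n --> ultraN] --> x i k.
  by move=> iN; apply: ulimP => n; exact: yB.
exists x; split.
- apply/funext => k; apply: ulimE.
  by under eq_fun do rewrite (let: And3 e _ _ := yP _ in e); exact: cvg_cst.
- apply/funext => k; apply: ulimE.
  by under eq_fun do rewrite (let: And3 _ e _ := yP _ in e); exact: cvg_cst.
move=> z z0 zN; apply: (@le_trans _ _ (inf E)); last first.
  by apply: ge_inf; [exact: Einf.2|exists z].
have Ecvg : denergy N (y n) @[n --> ultraN] --> denergy N x.
  apply: cvg_bigsum => i; rewrite mem_index_iota => /andP[_ iN].
  apply: cvgD.
    apply: cvgM; last exact: cvg_cst.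
    apply: cvg_bigsum => k _; apply: cvgM; first exact: cvg_cst.
    by apply: cvgM; apply: cvgB; apply: yx => //; exact: ltnW.
  apply: cvgM; first exact: cvg_cst.
  by apply: loclip_cvg => // k; exact/yx/ltnW.
have invcvg : inf E + n.+1%:R^-1 @[n --> ultraN] --> inf E + 0.
  apply: cvgD; first exact: cvg_cst.
  by apply: cvg_trans (@cvg_harmonic R) => A /ultraN_oo.
rewrite -[inf E]addr0; apply: ler_cvg_to Ecvg invcvg _.
by apply: nearW => n; have [_ _ /ltW] := yP n.
Qed.

(** Moving one coordinate of the interior node [i.+1] by [t] changes only the two adjacent cells.
    The energy increment is at most a quadratic in [t] without constant term, so its linear
    coefficient vanishes. *)
Lemma denergy_EL N x a b i k : (i.+1 < N)%N -> x 0%N = a -> x N = b ->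
  (forall y : nat -> I -> R, y 0%N = a -> y N = b -> denergy N x <= denergy N y) ->
  (x i.+2 k - x i.+1 k) / mesh N =
  (x i.+1 k - x i k) / mesh N + mesh N * (df k (x i.+1) / al k).
Proof.
move=> iN x0 xN xmin; have N0 : (0 < N)%N by exact: leq_trans iN.
set h := mesh N; have h0 : 0 < h by exact: mesh_gt0.
pose y t j m := if (j == i.+1) && (m == k) then x j m + t else x j m.
have yx t j : j != i.+1 -> y t j = x j.
  by move=> /negbTE ji; apply/funext => m; rewrite /y ji.
have yi t : y t i.+1 = fun m => if m == k then x i.+1 m + t else x i.+1 m.
  by apply/funext => m; rewrite /y eqxx.
have ymin t : denergy N x <= denergy N (y t).
  by apply: xmin; rewrite yx// gtn_eqF.
have [C fC] := f_der (x i.+1) k.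
(* The derivative at [t = 0] of the energy of the perturbed path [y t]. *)
pose A := al k * ((x i.+1 k - x i k) - (x i.+2 k - x i.+1 k)) / h + h * df k (x i.+1).
have quad t : `|t| <= 1 -> 0 <= t * A + (al k / h + h * C) * t ^+ 2.
  move=> t1; have := ymin t; rewrite -subr_ge0 /denergy.
  (* The cells before [i] and after [i.+1] cancel; two terms remain. *)
  rewrite -sumrB (@big_cat_nat _ _ _ i)//=; last by rewrite ltnW// ltnW.
  rewrite big1_seq ?add0r; last first.
    move=> j /andP[_]; rewrite mem_index_iota => /andP[_ ji].
    by rewrite !yx ?subrr// ltn_eqF// ltnS// ltnW.
  rewrite big_ltn; last by rewrite ltnW.
  rewrite big_ltn// big1_seq ?addr0; last first.
    move=> j /andP[_]; rewrite mem_index_iota => /andP[ij _].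
    by rewrite !yx ?subrr// gtn_eqF// ltnW.
  rewrite [y t i]yx ?ltn_eqF// [y t i.+2]yx ?gtn_eqF// yi.
  rewrite /denergy_cell -/h (bigD1 k)//= [in X in _ - X + _](bigD1 k)//=.
  rewrite [in X in _ + (X - _)](bigD1 k)//= [in X in _ + (_ - X)](bigD1 k)//= eqxx.
  under eq_bigr => m /negbTE mk do rewrite mk.
  under [in X in _ + (X - _)]eq_bigr => m /negbTE mk do rewrite mk.
  set S1 := \sum_(m | _) _; set S2 := \sum_(m | _) _.
  move=> H; have := fC t t1; set F1 := f _; rewrite -/F1 in H => F1C.
  have hF : h * F1 <= h * (f (x i.+1) + t * df k (x i.+1) + C * t ^+ 2).
    by rewrite ler_pM2l.
  apply: (le_trans H); rewrite -subr_ge0 in hF; rewrite -subr_ge0.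
  apply: (le_trans hF); rewrite le_eqVlt; apply/orP; left; apply/eqP.
  by rewrite /A; field; rewrite gt_eqF.
have A0 : A = 0.
  apply/eqP; rewrite -normr_eq0 eq_le normr_ge0 andbT leNgt; apply/negP => A0.
  (* [D] dominates the quadratic coefficient, and is large enough for [t = - A / (2 D)] to be an
     admissible perturbation. At this [t] the quadratic is at most [- A^2 / (4 D)]. *)
  pose D : R := `|al k / h + h * C| + `|A| + 1.
  have D0 : 0 < D by rewrite ltr_wpDl// addr_ge0.
  have := quad (- A / (2 * D)) _.
  have AD : `|- A / (2 * D)| <= 1.
    rewrite normrM normrN normfV (gtr0_norm (x := 2 * D)) ?mulr_gt0//.
    rewrite ler_pdivrMr ?mulr_gt0// mul1r; rewrite /D.
    have := normr_ge0 (al k / h + h * C); have := normr_ge0 A; lra.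
  move=> /(_ AD); apply/negP; rewrite -ltNge.
  apply: (@le_lt_trans _ _ (- A / (2 * D) * A + D * (- A / (2 * D)) ^+ 2)).
    rewrite lerD2l ler_wpM2r ?sqr_ge0// (le_trans (ler_norm _))// /D.
    by rewrite -addrA lerDl addr_ge0.
  have -> : - A / (2 * D) * A + D * (- A / (2 * D)) ^+ 2 = - (A ^+ 2 / (4 * D)).
    by field; rewrite gt_eqF.
  rewrite oppr_lt0; apply: divr_gt0; last by rewrite mulr_gt0.
  by rewrite exprn_even_gt0//= -normr_gt0.
have ak := al_gt0 k.
apply/eqP; rewrite -subr_eq0; apply/eqP.
transitivity (- A / al k); last by rewrite A0 oppr0 mul0r.
by rewrite /A; field; rewrite !gt_eqF.
Qed.

End DiscreteProblem.
(** * Passage to the limit *)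

Section Interpolation.
Context {R : realType}.
Implicit Types (s t : nat -> nat -> R) (x y B L : R).

(** For [x] in [Omega], the index of the last node not exceeding [x]. Stage [n] uses the grid with
    [n.+1] cells, so that the number of cells is never zero. *)
Definition node (n : nat) x : nat := Num.truncn ((x + 1) / mesh n.+1).

Lemma node_itv n x : -1 <= x ->
  (node n x)%:R * mesh n.+1 <= x + 1 < ((node n x)%:R + 1) * mesh n.+1.
Proof.
move=> x1; have h0 : (0 : R) < mesh n.+1 by exact: mesh_gt0.
rewrite -ler_pdivlMr// -ltr_pdivrMr// natr1; apply: Num.Theory.truncn_itv.
by rewrite divr_ge0 ?(ltW h0)//; lra.
Qed.

Lemma node_le n x : x <= 1 -> (node n x <= n.+1)%N.
Proof.
move=> x1; have h0 : (0 : R) < mesh n.+1 by exact: mesh_gt0.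
rewrite Num.Theory.truncn_le_nat ltr_pdivrMr// -natr1 mulrDl mulr_mesh//; lra.
Qed.

Lemma node_mono n x y : x <= y -> (node n x <= node n y)%N.
Proof.
move=> xy; apply: Num.Theory.le_truncn.
by rewrite ler_pM2r ?lerD2r// invr_gt0 mesh_gt0.
Qed.

Lemma nodeN1 n : node n (-1 : R) = 0%N.
Proof. by rewrite /node addNr mul0r Num.Theory.truncn0. Qed.

Lemma node1 n : node n (1 : R) = n.+1.
Proof.
rewrite /node /mesh invf_div mulrCA mulrV ?mulr1 ?natrK//.
by rewrite unitfE lt0r_neq0.
Qed.

Lemma node_cvg x : -1 <= x ->
  (node n x)%:R * mesh n.+1 @[n --> ultraN] --> x + 1.
Proof.
move=> x1.
have hcvg : mesh n.+1 @[n --> ultraN] --> (0 : R).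
  rewrite -(mulr0 2); apply: cvgM; first exact: cvg_cst.
  by apply: cvg_trans (@cvg_harmonic R) => A /ultraN_oo.
apply: (@squeeze_cvgr _ ultraN _ R (fun n => x + 1 - mesh n.+1) (fun=> x + 1)).
- apply: nearW => n; have /andP[-> xn] := node_itv n x1; rewrite andbT.
  by move: xn; rewrite mulrDl mul1r; lra.
- by rewrite -[X in _ --> X]subr0; apply: cvgB => //; exact: cvg_cst.
- exact: cvg_cst.
Qed.

(** The pointwise ultralimit of the piecewise constant interpolants taken from the left nodes. *)
Definition ulim_path s x : R := ulim (fun n => s n (node n x)).

Lemma ulim_pathP s B x : (forall n i, (i <= n.+1)%N -> `|s n i| <= B) ->
  x <= 1 -> s n (node n x) @[n --> ultraN] --> ulim_path s x.
Proof. by move=> sB x1; apply: ulimP => n; apply/sB/node_le. Qed.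

Lemma path_lipschitz (s : nat -> R) N L (h : R) i d :
  (forall i, (i < N)%N -> `|s i.+1 - s i| <= L * h) -> (i + d <= N)%N ->
  `|s (i + d)%N - s i| <= L * (d%:R * h).
Proof.
move=> sL; elim: d => [|d IHd] iN.
  by rewrite addn0 subrr normr0 mul0r mulr0.
rewrite addnS in iN *; rewrite -(subrK (s (i + d)%N) (s (i + d).+1)) -addrA.
rewrite (le_trans (ler_normD _ _))// -natr1 mulrDl mul1r mulrDr [leRHS]addrC.
by apply: lerD; [exact: sL|exact: IHd (ltnW iN)].
Qed.

(** Each step adds its own defect [L h^2] and the drift of [t] since the base node, at most
    [L d h^2]. With the constant 2 the induction step has the slack [L h^2 (3 d + 1)]. *)
Lemma path_taylor (s t : nat -> R) N L (h : R) i d : 0 <= L ->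
  (forall i, (i < N)%N -> `|s i.+1 - s i - h * t i| <= L * h ^+ 2) ->
  (forall i, (i < N)%N -> `|t i.+1 - t i| <= L * h) -> (i + d <= N)%N -> 0 <= h ->
  `|s (i + d)%N - s i - d%:R * h * t i| <= 2 * L * (d%:R * h) ^+ 2.
Proof.
move=> L0 sL tL iN h0; elim: d iN => [|d IHd] iN.
  by rewrite addn0 !mul0r subrr subr0 normr0 expr0n mulr0.
have iN' : (i + d < N)%N by rewrite -addnS.
have -> : s (i + d.+1)%N - s i - d.+1%:R * h * t i =
    (s (i + d).+1 - s (i + d)%N - h * t (i + d)%N) +
    (s (i + d)%N - s i - d%:R * h * t i) + h * (t (i + d)%N - t i).
  by rewrite addnS -natr1; ring.
have H1 := sL _ iN'; have H2 := IHd (ltnW iN').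
have H3 : `|h * (t (i + d)%N - t i)| <= h * (L * (d%:R * h)).
  rewrite normrM (ger0_norm h0) ler_wpM2l//.
  exact: path_lipschitz tL (ltnW iN').
apply: (le_trans (ler_normD _ _)); apply: le_trans (lerD (ler_normD _ _) H3) _.
apply: le_trans (lerD (lerD H1 H2) (lexx _)) _.
rewrite -subr_ge0 -(natr1 d).
have -> : 2 * L * ((d%:R + 1) * h) ^+ 2 - (L * h ^+ 2 + 2 * L * (d%:R * h) ^+ 2 +
  h * (L * (d%:R * h))) = L * h ^+ 2 * (3 * d%:R + 1) by ring.
by rewrite mulr_ge0 ?mulr_ge0 ?sqr_ge0// addr_ge0// mulr_ge0.
Qed.

Lemma ulim_path_lipschitz s B L x y :
  (forall n i, (i <= n.+1)%N -> `|s n i| <= B) ->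
  (forall n i, (i < n.+1)%N -> `|s n i.+1 - s n i| <= L * mesh n.+1) ->
  -1 <= x -> x <= y -> y <= 1 ->
  `|ulim_path s y - ulim_path s x| <= L * (y - x).
Proof.
move=> sB sL x1 xy y1; have xle1 := le_trans xy y1; have yge1 := le_trans x1 xy.
have -> : y - x = (y + 1) - (x + 1) by lra.
apply: (@ler_cvg_to _ ultraN _ R (fun n => `|s n (node n y) - s n (node n x)|)
  (fun n => L * ((node n y)%:R * mesh n.+1 - (node n x)%:R * mesh n.+1))).
- exact: cvg_norm (cvgB (ulim_pathP sB y1) (ulim_pathP sB xle1)).
- exact: cvgM (cvg_cst _) (cvgB (node_cvg yge1) (node_cvg x1)).
apply: nearW => n; have nxy := node_mono n xy.
rewrite -(subnKC nxy) natrD mulrDl addrAC subrr add0r.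
by apply: path_lipschitz (sL n) _; rewrite subnKC// node_le.
Qed.

(** The discrete estimate between the nodes of [x] and [y] is a non-strict inequality between
    convergent quantities, hence survives the ultralimit. *)
Lemma ulim_path_taylor s t B L x y : 0 <= L ->
  (forall n i, (i <= n.+1)%N -> `|s n i| <= B) ->
  (forall n i, (i <= n.+1)%N -> `|t n i| <= B) ->
  (forall n i, (i < n.+1)%N ->
    `|s n i.+1 - s n i - mesh n.+1 * t n i| <= L * mesh n.+1 ^+ 2) ->
  (forall n i, (i < n.+1)%N -> `|t n i.+1 - t n i| <= L * mesh n.+1) ->
  -1 <= x -> x <= y -> y <= 1 ->
  `|ulim_path s y - ulim_path s x - (y - x) * ulim_path t x| <=
    2 * L * (y - x) ^+ 2.
Proof.
move=> L0 sB tB sL tL x1 xy y1.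
have xle1 := le_trans xy y1; have yge1 := le_trans x1 xy.
have -> : y - x = (y + 1) - (x + 1) by lra.
pose d n : R := (node n y)%:R * mesh n.+1 - (node n x)%:R * mesh n.+1.
have dcvg : d n @[n --> ultraN] --> (y + 1) - (x + 1).
  by apply: cvgB; exact: node_cvg.
apply: (@ler_cvg_to _ ultraN _ R
  (fun n => `|s n (node n y) - s n (node n x) - d n * t n (node n x)|)
  (fun n => 2 * L * d n ^+ 2)).
- apply: cvg_norm (cvgB (cvgB (ulim_pathP sB y1) (ulim_pathP sB xle1)) _).
  exact: cvgM dcvg (ulim_pathP tB xle1).
- exact: cvgM (cvg_cst _) (cvgM dcvg dcvg).
apply: nearW => n; have nxy := node_mono n xy.
have -> : d n = (node n y - node n x)%N%:R * mesh n.+1.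
  by rewrite /d -mulrBl natrB.
rewrite -{1}(subnKC nxy).
apply: path_taylor (sL n) (tL n) _ _ => //; first by rewrite subnKC// node_le.
by rewrite ltW// mesh_gt0.
Qed.

(** The difference quotient at increment [h] is within [|C| |h|] of [d]. *)
Lemma quadratic_is_derive (F : R -> R) (x d C e : R) : 0 < e ->
  (forall y, `|y - x| < e -> `|F y - F x - (y - x) * d| <= C * (y - x) ^+ 2) ->
  is_derive x 1 F d.
Proof.
move=> e0 FC.
have lim : h^-1 *: (F (h *: 1 + x) - F x) @[h --> (0 : R)^'] --> d.
  apply/cvgrPdist_le => eps eps0.
  near=> h.
  have h0 : h != 0 by near: h; exact: nbhs_dnbhs_neq.
  have he : `|h| < e.
    by near: h; apply: dnbhs0_lt.
  have hC : (`|C| + 1) * `|h| < eps.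
    rewrite -ltr_pdivlMl ?ltr_wpDl//.
    by near: h; apply: dnbhs0_lt; rewrite mulr_gt0// invr_gt0 ltr_wpDl.
  have := FC (h + x); rewrite addrK => /(_ he).
  rewrite /GRing.scale/= mulr1 => H.
  have -> : d - h^-1 * (F (h + x) - F x) = - (h^-1 * (F (h + x) - F x - h * d)).
    by field.
  rewrite normrN normrM normfV ler_pdivrMl ?normr_gt0//.
  apply: (le_trans H); apply: (@le_trans _ _ (`|C| * h ^+ 2)).
    by rewrite ler_wpM2r ?sqr_ge0// ler_norm.
  rewrite -(real_normK (num_real h)) expr2 mulrCA ler_wpM2l//.
  by apply: le_trans (ltW hC); rewrite ler_wpM2r// lerDl.
by split; [apply/cvg_ex; exists d|exact: cvg_lim].
Unshelve. all: by end_near. Qed.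

(** The Taylor estimate only expands to the right of its base point. For [y < x] it is used at [y],
    and the Lipschitz bound on [t] moves the slope from [y] to [x]; this raises the constant from
    [2 L] to [3 L]. *)
Lemma ulim_path_is_derive s t B L x : 0 <= L ->
  (forall n i, (i <= n.+1)%N -> `|s n i| <= B) ->
  (forall n i, (i <= n.+1)%N -> `|t n i| <= B) ->
  (forall n i, (i < n.+1)%N ->
    `|s n i.+1 - s n i - mesh n.+1 * t n i| <= L * mesh n.+1 ^+ 2) ->
  (forall n i, (i < n.+1)%N -> `|t n i.+1 - t n i| <= L * mesh n.+1) ->
  -1 < x < 1 -> is_derive x 1 (ulim_path s) (ulim_path t x).
Proof.
move=> L0 sB tB sL tL /andP[x1 x2].
apply: (@quadratic_is_derive _ _ _ (3 * L) (Num.min (x + 1) (1 - x))).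
  by rewrite lt_min; apply/andP; split; lra.
move=> y; rewrite lt_min !ltr_norml => /andP[/andP[y1 y2] /andP[y3 y4]].
have [xy|yx] := leP x y.
  apply: (le_trans (ulim_path_taylor L0 sB tB sL tL _ xy _)); [lra|lra|].
  by rewrite ler_wpM2r ?sqr_ge0//; lra.
have H1 := ulim_path_taylor L0 sB tB sL tL (_ : -1 <= y) (ltW yx) (ltW x2).
have H2 := ulim_path_lipschitz tB tL (_ : -1 <= y) (ltW yx) (ltW x2).
have -> : ulim_path s y - ulim_path s x - (y - x) * ulim_path t x =
  - (ulim_path s x - ulim_path s y - (x - y) * ulim_path t y) +
  (x - y) * (ulim_path t x - ulim_path t y) by ring.
rewrite (le_trans (ler_normD _ _))// normrN.
have -> : 3 * L * (y - x) ^+ 2 = 2 * L * (x - y) ^+ 2 + (x - y) * (L * (x - y)).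
  by ring.
rewrite lerD ?H1//; first by lra.
rewrite normrM ger0_norm; last by lra.
by rewrite ler_wpM2l ?H2//; lra.
Qed.

End Interpolation.

(** * Equi-Lipschitz families of grid functions *)

Section LipschitzPaths.
Context {R : realType}.
Implicit Types (s t : nat -> nat -> R).

(** Bounds and Lipschitz constants, measured in grid distance, that are uniform over all grids. One
    [L] serves for both. *)
Definition equilip s := exists2 L : R, 0 <= L & forall n i,
  ((i <= n.+1)%N -> `|s n i| <= L) /\
  ((i < n.+1)%N -> `|s n i.+1 - s n i| <= L * mesh n.+1).

Definition lipschitz_on_Omega (F : R -> R) := exists L : R,
  forall x y, -1 <= x -> x <= y -> y <= 1 -> `|F y - F x| <= L * (y - x).

Lemma equilip_uniform {J : finType} (z : nat -> nat -> J -> R) :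
  (forall j, equilip (fun n i => z n i j)) ->
  exists2 L : R, 0 <= L & forall n i j,
  ((i <= n.+1)%N -> `|z n i j| <= L) /\
  ((i < n.+1)%N -> `|z n i.+1 j - z n i j| <= L * mesh n.+1).
Proof.
move=> zL; have /choice[L LP] j : exists L : R, 0 <= L /\ forall n i,
    ((i <= n.+1)%N -> `|z n i j| <= L) /\
    ((i < n.+1)%N -> `|z n i.+1 j - z n i j| <= L * mesh n.+1).
  by have [L L0 LP] := zL j; exists L.
have L0 j : 0 <= L j by exact: (LP j).1.
exists (\sum_j L j) => [|n i j]; first by rewrite sumr_ge0.
have Lj : L j <= \sum_j L j by rewrite (bigD1 j)//= lerDl sumr_ge0.
have [z1 z2] := (LP j).2 n i; split=> [/z1|/z2] /le_trans; apply => //.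
by rewrite ler_wpM2r// ltW// mesh_gt0.
Qed.

Lemma equilip_comp {J : finType} (g : (J -> R) -> R) (z : nat -> nat -> J -> R) :
  loclip g -> (forall j, equilip (fun n i => z n i j)) ->
  equilip (fun n i => g (z n i)).
Proof.
move=> hg /equilip_uniform[L L0 zL].
have [B B0 gB] := loclip_bounded L hg; have [C C0 gC] := hg L.
have S0 : 0 <= C * \sum_(j : J) L by rewrite mulr_ge0// sumr_ge0.
exists (B + C * \sum_(j : J) L) => [|n i]; first exact: addr_ge0.
have h0 : (0 : R) <= mesh n.+1 by rewrite ltW// mesh_gt0.
split=> iN.
  by rewrite (le_trans (gB _ _)) ?lerDl// => j; apply: (zL n i j).1.
apply: le_trans (gC _ _ _ _) _ => [j|j|].
- exact: (zL n i.+1 j).1.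
- exact/(zL n i j).1/ltnW.
rewrite mulrDl -[leLHS]add0r lerD ?mulr_ge0// -mulrA ler_wpM2l//.
by rewrite mulr_suml ler_sum// => j _; apply: (zL n i j).2.
Qed.

Lemma ulim_path_comp {J : finType} (g : (J -> R) -> R)
    (z : nat -> nat -> J -> R) x :
  loclip g -> (forall j, equilip (fun n i => z n i j)) -> x <= 1 ->
  ulim_path (fun n i => g (z n i)) x =
  g (fun j => ulim_path (fun n i => z n i j) x).
Proof.
move=> hg zL x1; apply: ulimE; apply: loclip_cvg => // j; have [L _ zjL] := zL j.
by apply: (@ulim_pathP _ (fun n i => z n i j) L) => // n i; case: (zjL n i).
Qed.

Lemma equilip_lipschitz s : equilip s -> lipschitz_on_Omega (ulim_path s).
Proof.
move=> [L L0 sL]; exists L => x y; apply: (@ulim_path_lipschitz _ _ L).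
- by move=> n i; case: (sL n i).
- by move=> n i; case: (sL n i).
Qed.

(** A difference relation with a defect of order [h^2] per step becomes an exact derivative in the
    limit. *)
Lemma equilip_is_derive s t : equilip s -> equilip t ->
  (exists C : R, forall n i, (i < n.+1)%N ->
    `|s n i.+1 - s n i - mesh n.+1 * t n i| <= C * mesh n.+1 ^+ 2) ->
  forall x : R, -1 < x < 1 -> is_derive x 1 (ulim_path s) (ulim_path t x).
Proof.
move=> [L1 L10 sL] [L2 L20 tL] [C CP] x.
have wk n i : (i < n.+1)%N ->
    `|s n i.+1 - s n i - mesh n.+1 * t n i| <= (`|C| + L2) * mesh n.+1 ^+ 2.
  move=> /CP /le_trans; apply; rewrite ler_wpM2r ?sqr_ge0//.
  by rewrite (le_trans (ler_norm _))// lerDl.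
apply: (@ulim_path_is_derive _ s t (L1 + L2) (`|C| + L2)) => //.
- exact: addr_ge0.
- by move=> n i /(sL n i).1 /le_trans; apply; rewrite lerDl.
- by move=> n i /(tL n i).1 /le_trans; apply; rewrite lerDr.
- move=> n i /(tL n i).2 /le_trans; apply; rewrite ler_wpM2r ?lerDr//.
  by rewrite ltW// mesh_gt0.
Qed.

End LipschitzPaths.

Section LocallyLipschitzExtra.
Context {R : realType}.

(** The map [e] may repeat indices, so each of the [#|I|] differences is bounded by the full sum
    over [J]. *)
Lemma loclip_reindex {I J : finType} (e : I -> J) (g : (I -> R) -> R) :
  loclip g -> loclip (fun z : J -> R => g (fun i => z (e i))).
Proof.
move=> hg B; have [C C0 gC] := hg B.
exists (C * #|I|%:R) => [|x y xB yB]; first by rewrite mulr_ge0.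
apply: le_trans (gC _ _ _ _) _ => //; rewrite -mulrA ler_wpM2l//.
rewrite mulr_natl -sumr_const ler_sum// => i _.
by rewrite [leRHS](bigD1 (e i))//= lerDl sumr_ge0.
Qed.

Lemma loclip_sum {I J : finType} (g : I -> (J -> R) -> R) :
  (forall i, loclip (g i)) -> loclip (fun x => \sum_i g i x).
Proof.
move=> hg; elim: (index_enum I) => [|i r IHr].
  by under eq_fun do rewrite big_nil; exact: loclip_cst.
by under eq_fun do rewrite big_cons; exact: loclipD.
Qed.

End LocallyLipschitzExtra.

(** * The limit of the discrete minimisers *)

Section DiscreteLimit.
Context {R : realType} {I : finType}.
Variables (al : I -> R) (f : (I -> R) -> R) (df : I -> (I -> R) -> R) (K : R).
Hypothesis al_gt0 : forall k, 0 < al k.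
Hypothesis f_ge : forall x, - K <= f x.
Hypothesis f_lip : loclip f.
Hypothesis df_lip : forall k, loclip (df k).
Hypothesis f_der : forall x k, exists C : R, forall t, `|t| <= 1 ->
  f (fun j => if j == k then x j + t else x j) <= f x + t * df k x + C * t ^+ 2.

Local Notation denergy := (denergy al f).

Definition density (p q : I -> R) : R := \sum_k al k / 2 * q k ^+ 2 + f p.

Lemma denergy_cell_density (h : R) (p q v : I -> R) : 0 < h ->
  (forall k, q k - p k = h * v k) -> denergy_cell al f h p q = h * density p v.
Proof.
move=> h0 pq; rewrite /denergy_cell /density mulrDr; congr (_ + _).
rewrite mulr_suml mulr_sumr; apply: eq_bigr => k _; rewrite pq.
by field; rewrite gt_eqF.
Qed.

(** State and slope are merged into one vector indexed by [I + I], so that the composition lemmas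
    for locally Lipschitz functions apply to the density. *)
Lemma loclip_density :
  loclip (fun z : I + I -> R => density (z \o inl) (z \o inr)).
Proof.
apply: loclipD; last exact: (@loclip_reindex _ _ _ inl).
apply: loclip_sum => k; apply: loclipM; first exact: loclip_cst.
exact/loclipX/loclip_proj.
Qed.

Variables a b : I -> R.

Section Slopes.
Variable x : nat -> nat -> I -> R.
Hypothesis x0 : forall n, x n 0%N = a.
Hypothesis xN : forall n, x n n.+1 = b.
Hypothesis xmin : forall n (y : nat -> I -> R),
  y 0%N = a -> y n.+1 = b -> denergy n.+1 (x n) <= denergy n.+1 y.

(* The last slope is defined so that the discrete Euler-Lagrange equation also
   holds at the right end point. *)
Definition slope (n i : nat) (k : I) : R :=
  if (i <= n)%N then (x n i.+1 k - x n i k) / mesh n.+1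
  else (x n n.+1 k - x n n k) / mesh n.+1 + mesh n.+1 * (df k (x n n.+1) / al k).

Lemma slopeE n i k : (i < n.+1)%N ->
  x n i.+1 k - x n i k = mesh n.+1 * slope n i k.
Proof.
rewrite ltnS /slope => ->; rewrite mulrC divfK// gt_eqF//; exact: mesh_gt0.
Qed.

Lemma slopeS n i k : (i < n.+1)%N ->
  slope n i.+1 k = slope n i k + mesh n.+1 * (df k (x n i.+1) / al k).
Proof.
rewrite /slope ltnS => iN; rewrite iN; case: ltnP => ni.
  exact: (denergy_EL al_gt0 f_der k (_ : (i.+1 < n.+1)%N)
    (x0 n) (xN n) (xmin (n := n))).
by have -> : i = n by apply/eqP; rewrite eqn_leq iN.
Qed.

(** The energy of a minimiser is at most that of the affine path, which is bounded uniformly in the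
    grid. *)
Lemma minimisers_bounded : exists B : R, forall n i k,
  (i <= n.+1)%N -> `|x n i k| <= B.
Proof.
have [C CP] := denergy_affine_path al f_lip a b.
pose B k : R := `|a k| + (1 + (C + 2 * K) / al k).
exists (\sum_k `|B k|) => n i k iN; apply: (@le_trans _ _ (B k)); last first.
  by rewrite (le_trans (ler_norm _))// (bigD1 k)//= lerDl sumr_ge0.
rewrite -[x n i k](subrK (a k)) (le_trans (ler_normD _ _))// addrC lerD2l.
rewrite -(x0 n); apply: (denergy_bounded al_gt0 f_ge) iN => //.
apply: le_trans (CP n.+1 _) => //; apply: xmin.
  by rewrite affine_path0.
by rewrite affine_pathN.
Qed.

(** By the discrete Euler-Lagrange equation the slopes are Lipschitz along the grid, so they
    oscillate by a bounded amount. Their mean is [(b - a) / 2], which bounds each of them. *)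
Lemma slope_bounded : exists B : R, forall n i k,
  (i <= n.+1)%N -> `|slope n i k| <= B.
Proof.
have [B xB] := minimisers_bounded.
have /choice[D DP] k : exists D : R, 0 <= D /\ forall p : I -> R,
    (forall j, `|p j| <= B) -> `|df k p / al k| <= D.
  have [D D0 DP] := loclip_bounded B (loclipM (df_lip k) (loclip_cst (al k)^-1)).
  by exists D.
have vL n i k : (i < n.+1)%N -> `|slope n i.+1 k - slope n i k| <= D k * mesh n.+1.
  move=> iN; rewrite slopeS// addrC addKr normrM ger0_norm; last first.
    by rewrite ltW// mesh_gt0.
  rewrite mulrC ler_wpM2r//; first by rewrite ltW// mesh_gt0.
  by have [_] := DP k; apply => j; apply: xB.
have vD n i j k : (i <= n.+1)%N -> (j <= n.+1)%N ->
    `|slope n j k - slope n i k| <= D k * 2.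
  wlog ij : i j / (i <= j)%N.
    by move=> H iN jN; case: (leqP i j) => [/H|/ltnW/H]; [|rewrite distrC]; apply.
  move=> iN jN; rewrite -(subnKC ij).
  have := @path_lipschitz _ (fun i => slope n i k) n.+1 (D k) (mesh n.+1) i (j - i)
     (fun i => vL n i k).
  rewrite subnKC// => /(_ jN)/le_trans; apply.
  rewrite ler_wpM2l ?(DP k).1// -(@mulr_mesh R n.+1)// ler_wpM2r//.
    by rewrite ltW// mesh_gt0.
  by rewrite ler_nat (leq_trans (leq_subr _ _)).
exists (\sum_k (`|b k - a k| / 2 + D k * 2)) => n i k iN.
apply: (@le_trans _ _ (`|b k - a k| / 2 + D k * 2)); last first.
  rewrite (bigD1 k)//= lerDl sumr_ge0// => j _.
  by rewrite addr_ge0// mulr_ge0// (DP j).1.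
rewrite -(ler_pM2l (ltr0n _ 2)) mulrDr [X in _ <= X + _]mulrC divfK//.
rewrite -[X in X * `|_|]ger0_norm// -normrM.
(* The cell lengths add up to 2, and the sum of [mesh * slope] telescopes to [b - a]. *)
have -> : 2 * slope n i k =
    (b k - a k) + \sum_(0 <= j < n.+1) (mesh n.+1 * (slope n i k - slope n j k)).
  rewrite -(x0 n) -(xN n) -(@telescope_sumr _ 0 n.+1 (fun j => x n j k))//.
  rewrite -big_split/= -(sumr_mesh _ (ltn0Sn n)); apply: eq_big_nat => j /andP[_ jN].
  by rewrite slopeE// -mulrDr addrC subrK.
rewrite (le_trans (ler_normD _ _))// lerD2l (le_trans (ler_norm_sum _ _ _))//.
rewrite -(sumr_mesh _ (ltn0Sn n)); apply: ler_sum_nat => j /andP[_ jN].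
rewrite normrM ger0_norm; last by rewrite ltW// mesh_gt0.
by rewrite ler_wpM2l ?vD ?(ltnW jN)// ltW// mesh_gt0.
Qed.

Lemma equilip_state : forall j : I + I, equilip (fun n i =>
  match j with inl k => x n i k | inr k => slope n i k end).
Proof.
have [B1 xB] := minimisers_bounded; have [B2 vB] := slope_bounded.
move=> [k|k].
- exists (`|B1| + `|B2|) => [|n i]; first by rewrite addr_ge0.
  split=> iN.
    by rewrite (le_trans (xB _ _ _ iN))// (le_trans (ler_norm _))// lerDl.
  rewrite slopeE// normrM ger0_norm; last by rewrite ltW// mesh_gt0.
  rewrite mulrC ler_wpM2r//; first by rewrite ltW// mesh_gt0.
  by rewrite (le_trans (vB _ _ _ (ltnW iN)))// (le_trans (ler_norm _))// lerDr.
- have [D D0 DP] := loclip_bounded B1 (loclipM (df_lip k) (loclip_cst (al k)^-1)).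
  exists (`|B2| + D) => [|n i]; first by rewrite addr_ge0.
  split=> iN.
    by rewrite (le_trans (vB _ _ _ iN))// (le_trans (ler_norm _))// lerDl.
  rewrite slopeS// addrC addKr normrM ger0_norm; last by rewrite ltW// mesh_gt0.
  rewrite mulrC ler_wpM2r//; first by rewrite ltW// mesh_gt0.
  apply: le_trans (DP _ _) _; last by rewrite lerDr.
  by move=> j; apply: xB.
Qed.

End Slopes.

Theorem discrete_limit : exists u v : I -> R -> R, exists e : R -> R,
  [/\ forall k, u k (-1) = a k /\ u k 1 = b k,
      forall k, lipschitz_on_Omega (u k) /\ lipschitz_on_Omega (v k),
      forall k (x : R), -1 < x < 1 -> is_derive x 1 (u k) (v k x) /\
        is_derive x 1 (v k) (df k (u ^~ x) / al k),
      [/\ e (-1) = 0, lipschitz_on_Omega e & forall x : R, -1 < x < 1 ->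
          is_derive x 1 e (density (u ^~ x) (v ^~ x))]
    & forall (w : R -> I -> R) (C : R), w (-1) = a -> w 1 = b ->
      (\forall n \near \oo,
        denergy n.+1 (fun i => w (-1 + i%:R * mesh n.+1)) <= C) -> e 1 <= C].
Proof.
have /choice[x xP] n := denergy_minimiser al_gt0 f_ge f_lip a b (ltn0Sn n).
have x0 n : x n 0%N = a by case: (xP n).
have xN n : x n n.+1 = b by case: (xP n).
have xmin n : forall y : nat -> I -> R,
  y 0%N = a -> y n.+1 = b -> denergy n.+1 (x n) <= denergy n.+1 y by case: (xP n).
pose v := slope x.
pose z n i (j : I + I) := match j with inl k => x n i k | inr k => v n i k end.
have zL j : equilip (fun n i => z n i j) := equilip_state x0 xN xmin j.
have xL k : equilip (fun n i => x n i k) := zL (inl k).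
have vL k : equilip (fun n i => v n i k) := zL (inr k).
pose kap k p := df k p * (al k)^-1.
have kL k : loclip (kap k) by apply: loclipM => //; exact: loclip_cst.
pose G n i := density (x n i) (v n i).
have GL : equilip G by exact: (equilip_comp loclip_density zL).
(* Left Riemann sums of the density, that is, the discrete energy of the first [i] cells. *)
pose e n i := \sum_(0 <= j < i) (mesh n.+1 * G n j).
have eS n i : e n i.+1 - e n i = mesh n.+1 * G n i.
  by rewrite /e big_nat_recr//= addrAC subrr add0r.
have eL : equilip e.
  have [L L0 LP] := GL; exists (2 * L) => [|n i]; first by rewrite mulr_ge0.
  have h0 : (0 : R) <= mesh n.+1 by rewrite ltW// mesh_gt0.
  split=> iN; last first.
    rewrite eS normrM ger0_norm// mulrC ler_wpM2r//.
    by rewrite (le_trans ((LP n i).1 (ltnW iN)))// mulr_natl mulr2n lerDl.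
  rewrite (le_trans (ler_norm_sum _ _ _))// -(sumr_mesh _ (ltn0Sn n)).
  rewrite [leRHS](@big_cat_nat _ _ _ i)//= -[leLHS]addr0 lerD//; last first.
    by rewrite sumr_ge0// => j _; rewrite mulr_ge0.
  apply: ler_sum_nat => j /andP[_ ji]; rewrite normrM ger0_norm// ler_wpM2l//.
  by apply: (LP n j).1; rewrite (leq_trans (ltnW ji)).
exists (fun k => ulim_path (fun n i => x n i k)).
exists (fun k => ulim_path (fun n i => v n i k)).
exists (ulim_path e); split.
- move=> k; rewrite /ulim_path; split.
    by under eq_fun do rewrite nodeN1 x0; exact: ulim_cst.
  by under eq_fun do rewrite node1 xN; exact: ulim_cst.
- by move=> k; split; exact: equilip_lipschitz.
- move=> k y y1; split.
    apply: (equilip_is_derive (xL k) (vL k)) y1.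
    by exists 0 => n i iN; rewrite slopeE// subrr normr0 mul0r.
  have <- : ulim_path (fun n i => kap k (x n i)) y =
      df k (fun k => ulim_path (fun n i => x n i k) y) / al k.
    by apply: ulim_path_comp => //; lra.
  have KL := equilip_comp (kL k) xL.
  apply: (equilip_is_derive (vL k) KL) y1.
  have [L L0 LP] := KL; exists L => n i iN.
  have h0 : (0 : R) <= mesh n.+1 by rewrite ltW// mesh_gt0.
  (* The discrete equation evaluates [kap k] at the right node of the cell; replacing it by the left
     node costs [h] times one increment of [kap k], hence at most [L h^2]. *)
  rewrite /v (slopeS x0 xN xmin)// (addrAC (slope x n i k)) subrr add0r.
  rewrite -mulrBr normrM ger0_norm//.
  by rewrite expr2 mulrA [leRHS]mulrC ler_wpM2l//; exact: (LP n i).2.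
- split.
  + rewrite /ulim_path; under eq_fun do rewrite nodeN1 /e big_nil.
    exact: ulim_cst.
  + exact: equilip_lipschitz.
  + move=> y y1.
    have <- : ulim_path G y = density (fun k => ulim_path (fun n i => x n i k) y)
        (fun k => ulim_path (fun n i => v n i k) y).
      by apply: (ulim_path_comp loclip_density zL); lra.
    apply: (equilip_is_derive eL GL) y1.
    by exists 0 => n i iN; rewrite eS subrr normr0 mul0r.
- move=> w C w0 w1 wC.
  have e1 : e n n.+1 @[n --> ultraN] --> ulim_path e 1.
    rewrite /ulim_path; under [in ulim _]eq_fun do rewrite node1.
    by have [L _ LP] := eL; apply: (@ulimP _ _ L) => n; exact: (LP n n.+1).1.
  apply: (cvgr_to_le e1); apply: ultraN_oo; apply: filterS wC => n; apply: le_trans.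
  (* The total of the partial energies is the minimal discrete energy, which the grid values of [w]
     cannot undercut. *)
  have -> : e n n.+1 = denergy n.+1 (x n).
    apply: eq_big_nat => i /andP[_ iN]; rewrite (@denergy_cell_density _ _ _ (v n i))//.
      exact: mesh_gt0.
    by move=> k; exact: slopeE.
  apply: xmin; first by rewrite mul0r addr0.
  by rewrite mulr_mesh//; rewrite (_ : -1 + 2 = 1)//; lra.
Qed.

End DiscreteLimit.
(** * Smooth plateau functions *)

Section SmoothFunctions.
Context {R : realType}.
Implicit Types (f g : R -> R) (n : nat).

(** Differentiability to order [n]. Recursion through the first derivative turns closure under
    algebraic operations into inductions on [n]. *)
Fixpoint Cn n f : Prop :=
  if n is m.+1 then (forall y, derivable f y 1) /\ Cn m f^`() else True.

Lemma CnS n f : Cn n.+1 f -> Cn n f.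
Proof. by elim: n f => [|n IHn] f [df Cf] //; split=> //; exact: IHn. Qed.

Lemma Cn_cst n (c : R) : Cn n (fun=> c).
Proof.
elim: n c => [//|n IHn] c; split=> [y|]; first exact: derivable_cst.
have -> : (fun=> c : R)^`() = (fun=> 0 : R) by apply/funext => y; exact: derive1_cst.
exact: IHn.
Qed.

Lemma CnD n f g : Cn n f -> Cn n g -> Cn n (fun y => f y + g y).
Proof.
elim: n f g => [//|n IHn] f g [df Cf] [dg Cg]; split=> [y|].
  exact: derivableD.
have -> : (fun y => f y + g y)^`() = (fun y => f^`() y + g^`() y).
  by apply/funext => y; rewrite !derive1E deriveD.
exact: IHn.
Qed.

Lemma CnM n f g : Cn n f -> Cn n g -> Cn n (fun y => f y * g y).
Proof.
elim: n f g => [//|n IHn] f g Cf' Cg'; have [df Cf] := Cf'; have [dg Cg] := Cg'.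
split=> [y|]; first exact: derivableM.
have -> : (fun y => f y * g y)^`() = (fun y => f y * g^`() y + g y * f^`() y).
  by apply/funext => y; rewrite !derive1E deriveM.
by apply: CnD; apply: IHn => //; exact: CnS.
Qed.

(** The derivative of [1 / f] is a product of [f'] with powers of [1 / f], to which the induction
    hypothesis applies one order lower. *)
Lemma CnV n f : (forall y, f y != 0) -> Cn n f -> Cn n (fun y => (f y)^-1).
Proof.
move=> f0; elim: n f f0 => [//|n IHn] f f0 Cf'; have [df Cf] := Cf'.
split=> [y|]; first exact: derivableV.
have -> : (fun y => (f y)^-1)^`() = (fun y => -1 * (f y)^-1 * (f y)^-1 * f^`() y).
  apply/funext => y; rewrite !derive1E deriveV//.
  by rewrite /GRing.scale/= expr2 invfM mulN1r !mulNr.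
have CV := IHn f f0 (CnS Cf').
by apply: CnM => //; apply: CnM => //; apply: CnM => //; exact: Cn_cst.
Qed.

Lemma is_derive_affine f (c d y : R) : derivable f (c * y + d) 1 ->
  is_derive y 1 (fun y => f (c * y + d)) (f^`() (c * y + d) * c).
Proof.
move=> df; apply: (@is_derive1_comp _ f (fun y => c * y + d)).
  by rewrite derive1E; exact: derivableP.
have h1 : is_derive y 1 (fun y : R => c * y) c.
  have := is_deriveM (is_derive_cst c y (1 : R)) (is_derive_id y (1 : R)).
  by rewrite scaler0 addr0 /GRing.scale/= mulr1.
by rewrite -[X in is_derive _ _ _ X]addr0; apply: is_deriveD.
Qed.

Lemma Cn_affine n f (c d : R) : Cn n f -> Cn n (fun y => f (c * y + d)).
Proof.
elim: n f => [//|n IHn] f [df Cf].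
have dfc y := is_derive_affine (df (c * y + d)).
split=> [y|]; first by case: (dfc y).
have -> : (fun y => f (c * y + d))^`() = (fun y => f^`() (c * y + d) * c).
  by apply/funext => y; rewrite derive1E; case: (dfc y).
by apply: CnM; [exact: IHn|exact: Cn_cst].
Qed.

Lemma Cn_derivable f n (y : R) : (forall m, Cn m f) -> derivable f^`(n) y 1.
Proof.
elim: n f => [|n IHn] f Cf; first by case: (Cf 1%N).
by rewrite derive1Sn; apply: IHn => m; case: (Cf m.+1).
Qed.

End SmoothFunctions.

(** * The flat exponential and a smooth step *)

Section FlatExponential.
Context {R : realType}.
Implicit Types (p q : {poly R}) (x y : R).

(* Closed under differentiation, which makes [flat 1] smooth. *)
Definition flat p x : R := if 0 < x then p.[x^-1] * expR (- x^-1) else 0.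

(** For positive [k], the [k]-th power of [t / k <= expR (t / k)]. *)
Lemma exprn_expRN_le k (t : R) : 0 <= t -> t ^+ k * expR (- t) <= k%:R ^+ k.
Proof.
move=> t0; case: k => [|k]; first by rewrite !expr0 mul1r expR_le1 oppr_le0.
have k0 : (0 : R) < k.+1%:R by [].
rewrite expRN ler_pdivrMr ?expR_gt0//.
have -> : expR t = expR (t / k.+1%:R) ^+ k.+1.
  by rewrite -expRM_natl mulrC divfK// gt_eqF.
rewrite -exprMn lerXn2r ?nnegrE ?mulr_ge0 ?expR_ge0//.
rewrite -ler_pdivrMl// mulrC (le_trans _ (expR_ge1Dx _))// lerDr.
exact: ler01.
Qed.

Lemma flat_bounded p : exists2 C : R, 0 <= C & forall x, `|flat p x| <= C.
Proof.
exists (\sum_(i < size p) `|p`_i| * i%:R ^+ i) => [|x].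
  by rewrite sumr_ge0// => i _; rewrite mulr_ge0 ?exprn_ge0.
rewrite /flat; case: ifPn => [x0|_]; last first.
  by rewrite normr0 sumr_ge0// => i _; rewrite mulr_ge0 ?exprn_ge0.
rewrite horner_coef mulr_suml (le_trans (ler_norm_sum _ _ _))// ler_sum// => i _.
have xV : 0 <= x^-1 by rewrite invr_ge0 ltW.
rewrite -mulrA normrM ler_wpM2l// ger0_norm; last first.
  by rewrite mulr_ge0 ?expR_ge0 ?exprn_ge0.
exact: exprn_expRN_le.
Qed.

(** For positive [x] the chain rule gives the factor [x^-2 (p - p')] at [1 / x]. At 0,
    [flat p y = flat ('X^2 * p) y * y^2] with a bounded first factor, so the function is
    quadratically small. *)
Lemma is_derive_flat p x : is_derive x 1 (flat p) (flat ('X^2 * (p - deriv p)) x).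
Proof.
have [x0|x0|->] := ltgtP x 0.
- have -> : flat ('X^2 * (p - deriv p)) x = 0 by rewrite /flat ltNge (ltW x0).
  apply: (@quadratic_is_derive _ _ _ _ 0 (- x)) => [|y]; first by rewrite oppr_gt0.
  rewrite ltr_norml => /andP[_ yx]; have y0 : y < 0 by lra.
  by rewrite /flat !ltNge (ltW x0) (ltW y0)/= subrr mulr0 subrr normr0 mul0r.
- have dV : is_derive x 1 (fun y : R => y^-1) (- x ^- 2).
    have := @is_deriveV R id x 1 1 (lt0r_neq0 x0) (is_derive_id x (1 : R)).
    by rewrite /GRing.scale/= mulr1.
  have dp : is_derive x 1 (horner p \o (fun y : R => y^-1))
      ((deriv p).[x^-1] * - x ^- 2).
    by apply: is_derive1_comp; rewrite derivE derive1E; apply: derivableP.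
  have dN : is_derive x 1 (fun y : R => - y^-1) (x ^- 2).
    by rewrite -[X in is_derive _ _ _ X]opprK; exact: is_deriveN.
  have de : is_derive x 1 (expR \o (fun y : R => - y^-1))
      (expR (- x^-1) * x ^- 2).
    by apply: is_derive1_comp; exact: is_derive_expR.
  have := is_deriveM dp de; set D := (X in is_derive _ _ _ X -> _) => H.
  have -> : flat ('X^2 * (p - deriv p)) x = D.
    rewrite /flat x0 hornerM hornerXn hornerD hornerN /D /GRing.scale/=.
    by field; rewrite gt_eqF.
  apply: near_eq_is_derive H; near=> y.
  have y0 : 0 < y by near: y; exact: lt_nbhsr.
  by rewrite /flat y0.
- have [C C0 CP] := flat_bounded ('X^2 * p).
  rewrite {2}/flat ltxx.
  apply: (@quadratic_is_derive _ _ _ _ C 1) => // y _.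
  rewrite [flat p 0]/flat ltxx !subr0 mulr0 subr0.
  have [y0|y0] := ltP 0 y; last first.
    by rewrite /flat ltNge y0 normr0 mulr_ge0 ?sqr_ge0.
  have -> : flat p y = flat ('X^2 * p) y * y ^+ 2.
    by rewrite /flat y0 hornerM hornerXn; field; rewrite gt_eqF.
  by rewrite normrM (ger0_norm (sqr_ge0 y)) ler_wpM2r ?sqr_ge0.
Unshelve. all: by end_near. Qed.

Lemma Cn_flat n p : Cn n (flat p).
Proof.
elim: n p => [//|n IHn] p; split=> [y|]; first by case: (is_derive_flat p y).
have -> : (flat p)^`() = flat ('X^2 * (p - deriv p)).
  by apply/funext => y; rewrite derive1E; case: (is_derive_flat p y).
exact: IHn.
Qed.

(** A smooth transition from 0 on [x <= 0] to 1 on [x >= 1]; the denominator is positive because [x]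
    or [1 - x] is. *)
Definition smooth_step x : R := flat 1 x / (flat 1 x + flat 1 (1 - x)).

Lemma flat1_ge0 x : 0 <= flat 1 x.
Proof. by rewrite /flat; case: ifP => // _; rewrite hornerE mul1r expR_ge0. Qed.

Lemma flat1_gt0 x : 0 < x -> 0 < flat 1 x.
Proof. by rewrite /flat => ->; rewrite hornerE mul1r expR_gt0. Qed.

Lemma flat_le0 p x : x <= 0 -> flat p x = 0.
Proof. by rewrite /flat leNgt => /negbTE ->. Qed.

Lemma smooth_step_denom_gt0 x : 0 < flat 1 x + flat 1 (1 - x).
Proof.
have [x0|x0] := ltP 0 x; first by rewrite ltr_pwDl ?flat1_gt0 ?flat1_ge0.
by rewrite ltr_wpDl ?flat1_ge0// flat1_gt0//; lra.
Qed.

Lemma Cn_smooth_step n : Cn n smooth_step.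
Proof.
apply: CnM; first exact: Cn_flat.
apply: CnV => [y|]; first by rewrite gt_eqF ?smooth_step_denom_gt0.
apply: CnD; first exact: Cn_flat.
have -> : (fun y : R => flat 1 (1 - y)) = (fun y => flat 1 (-1 * y + 1)).
  by apply/funext => y; rewrite mulN1r addrC.
exact/Cn_affine/Cn_flat.
Qed.

Lemma smooth_step_le0 x : x <= 0 -> smooth_step x = 0.
Proof. by move=> x0; rewrite /smooth_step flat_le0// mul0r. Qed.

Lemma smooth_step_ge1 x : 1 <= x -> smooth_step x = 1.
Proof.
move=> x1; rewrite /smooth_step [flat 1 (1 - x)]flat_le0 ?subr_le0//.
by rewrite addr0 divff// gt_eqF// flat1_gt0// (lt_le_trans ltr01).
Qed.

Lemma smooth_step_itv x : 0 <= smooth_step x <= 1.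
Proof.
rewrite divr_ge0 ?flat1_ge0 ?(ltW (smooth_step_denom_gt0 _))//=.
by rewrite ler_pdivrMr ?smooth_step_denom_gt0// mul1r lerDl flat1_ge0.
Qed.

End FlatExponential.
(** * Weak derivatives on an interval *)

Section IntegralsOnIntervals.
Context {R : realType}.
Notation mu := (@lebesgue_measure R).
Implicit Types (f g w : R -> R) (A D : set R).

Lemma within_continuous_integrable (a b : R) f :
  {within `[a, b], continuous f} -> mu.-integrable `[a, b] (EFin \o f).
Proof.
by move=> cf; apply: continuous_compact_integrable => //; exact: segment_compact.
Qed.

Lemma within_continuousM (a b : R) f g :
  {within `[a, b], continuous f} -> {within `[a, b], continuous g} ->
  {within `[a, b], continuous (fun y => f y * g y)}.
Proof. by move=> cf cg z; apply: continuousM; [exact: cf|exact: cg]. Qed.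

Lemma within_continuous_normr (a b : R) f :
  {within `[a, b], continuous f} -> {within `[a, b], continuous (fun y => `|f y|)}.
Proof.
by move=> /subspace_continuousP cf; apply/subspace_continuousP => y /cf/cvg_norm.
Qed.

Lemma within_itvS (a b c d : R) f : a <= c -> d <= b ->
  {within `[a, b], continuous f} -> {within `[c, d], continuous f}.
Proof.
move=> ac db; apply: continuous_subspaceW => x /=.
by rewrite !in_itv/= => /andP[cx xd]; rewrite (le_trans ac cx) (le_trans xd db).
Qed.

Lemma Rintegral_support A D f : A `<=` D -> (forall x, D x -> ~ A x -> f x = 0) ->
  \int[mu]_(x in D) f x = \int[mu]_(x in A) f x.
Proof.
move=> AD f0; rewrite Rintegral_mkcond [RHS]Rintegral_mkcond.
apply: eq_Rintegral => x _; rewrite !patchE.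
case: ifPn => [/set_mem Dx|/negP Dx]; case: ifPn => //.
- by move=> /negP Ax; apply: f0 => // Ax'; apply/Ax/mem_set.
- by move=> /set_mem Ax; case: Dx; apply/mem_set/AD.
Qed.

Lemma Rintegral_FTC2 (a b : R) f (F : R -> R) : a < b ->
  {within `[a, b], continuous f} -> derivable_oo_LRcontinuous F a b ->
  {in `]a, b[, F^`() =1 f} -> \int[mu]_(x in `[a, b]) f x = F b - F a.
Proof. by move=> ab cf dF Ff; rewrite /Rintegral (continuous_FTC2 ab cf dF Ff). Qed.

Lemma derivable_LRcontinuous (F : R -> R) (a b : R) :
  (forall y, derivable F y 1) -> derivable_oo_LRcontinuous F a b.
Proof.
move=> dF; have cF y : F x @[x --> y] --> F y.
  exact/differentiable_continuous/derivable1_diffP.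
by split=> [y _ //||]; [apply: cvg_at_right_filter|apply: cvg_at_left_filter].
Qed.

Lemma fine_itv_measure (a b : R) : a <= b -> fine (mu `[a, b]) = b - a.
Proof.
rewrite lebesgue_measure_itv/= lte_fin; case: ltgtP => //= <- _.
by rewrite subrr.
Qed.

End IntegralsOnIntervals.

(** * Concentrating kernels *)

Section Mollifier.
Context {R : realType}.
Notation mu := (@lebesgue_measure R).
Implicit Types (c e y : R).

(** For positive [e], a transition from 0 at [c] to 1 at [c + e]. The argument is kept in the affine
    form to which [Cn_affine] and [is_derive_affine] apply. *)
Definition scaled_step c e y : R := smooth_step (e^-1 * y + (- c / e)).

Lemma scaled_stepE c e y : scaled_step c e y = smooth_step ((y - c) / e).
Proof. by rewrite /scaled_step -[e^-1 * y]mulrC -mulrDl. Qed.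

Lemma Cn_scaled_step c e n : Cn n (scaled_step c e).
Proof. exact/Cn_affine/Cn_smooth_step. Qed.

Lemma scaled_step_le c e y : 0 < e -> y <= c -> scaled_step c e y = 0.
Proof.
move=> e0 yc; rewrite scaled_stepE smooth_step_le0//.
by rewrite pmulr_lle0 ?invr_gt0// subr_le0.
Qed.

Lemma scaled_step_ge c e y : 0 < e -> c + e <= y -> scaled_step c e y = 1.
Proof.
move=> e0 yc; rewrite scaled_stepE smooth_step_ge1//.
by rewrite ler_pdivlMr// mul1r lerBrDl.
Qed.

Lemma scaled_step_itv c e y : 0 <= scaled_step c e y <= 1.
Proof. exact: smooth_step_itv. Qed.

Lemma derivable_scaled_step c e y : derivable (scaled_step c e) y 1.
Proof. by have [] := Cn_scaled_step c e 1. Qed.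

Lemma continuous_derive_scaled_step c e : continuous (scaled_step c e)^`().
Proof.
move=> y; have [_ [d2 _]] := Cn_scaled_step c e 2.
exact/differentiable_continuous/derivable1_diffP.
Qed.

(** The derivative is continuous on the compact [[0, 1]], and vanishes outside since the step is
    constant there. *)
Lemma derive_smooth_step_bounded : exists2 M : R, 0 <= M &
  forall z : R, `|smooth_step^`() z| <= M.
Proof.
have [_ [d2 _]] := @Cn_smooth_step R 2.
have cS : {within `[0, 1], continuous (fun z : R => `|smooth_step^`() z|)}.
  apply: continuous_subspaceT => z; apply: continuous_comp; last exact: norm_continuous.
  exact/differentiable_continuous/derivable1_diffP.
have [c _ cM] := EVT_max ler01 cS.
exists (`|smooth_step^`() c|) => // z.
have [z0|z0] := ltP z 0.
  rewrite derive1E -(@near_eq_derive R _ _ (fun=> 0 : R)) ?derive_cst ?normr0//.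
  by near=> y; rewrite smooth_step_le0//; apply/ltW; near: y; exact: lt_nbhsl.
have [z1|z1] := ltP 1 z.
  rewrite derive1E -(@near_eq_derive R _ _ (fun=> 1 : R)) ?derive_cst ?normr0//.
  by near=> y; rewrite smooth_step_ge1//; apply/ltW; near: y; exact: lt_nbhsr.
by apply: cM; rewrite in_itv/= z0.
Unshelve. all: by end_near. Qed.

Lemma derive_scaled_step c e y :
  (scaled_step c e)^`() y = e^-1 * smooth_step^`() ((y - c) / e).
Proof.
have [ds _] := @Cn_smooth_step R 1.
rewrite derive1E; case: (is_derive_affine (ds (e^-1 * y + (- c / e)))) => _ ->.
by rewrite mulrC [e^-1 * y]mulrC -mulrDl.
Qed.

Lemma derive_scaled_step_out c e y : 0 < e -> y < c \/ c + e < y ->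
  (scaled_step c e)^`() y = 0.
Proof.
move=> e0 [yc|yc]; rewrite derive1E.
  rewrite -(@near_eq_derive R _ _ (fun=> 0 : R)) ?derive_cst//.
  by near=> z; rewrite scaled_step_le//; apply/ltW; near: z; exact: lt_nbhsl.
rewrite -(@near_eq_derive R _ _ (fun=> 1 : R)) ?derive_cst//.
by near=> z; rewrite scaled_step_ge//; apply/ltW; near: z; exact: lt_nbhsr.
Unshelve. all: by end_near. Qed.

(** The derivative of the step is a kernel carried by [[c, c + e]], of integral 1 and of size at
    most [M / e]; its L^1 norm is thus at most [M], and averaging [w - w c] against it gives the
    bound. *)
Lemma mollifier_estimate : exists2 M : R, 0 <= M &
  forall (w : R -> R) c e eta, {within Omega R, continuous w} ->
  0 < e -> -1 <= c -> c + e <= 1 -> 0 <= eta ->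
  (forall y, c <= y <= c + e -> `|w y - w c| <= eta) ->
  `|\int[mu]_(y in Omega R) (w y * (scaled_step c e)^`() y) - w c| <= eta * M.
Proof.
have [M M0 SM] := derive_smooth_step_bounded.
exists M => // w c e eta cw e0 c1 ce1 eta0 weta.
set s := (scaled_step c e)^`().
have ce : c < c + e by rewrite ltrDl.
have cs : {within `[c, c + e], continuous s}.
  by apply: continuous_subspaceT; exact: continuous_derive_scaled_step.
have cw' : {within `[c, c + e], continuous w} by exact: within_itvS cw.
have s1 : \int[mu]_(y in `[c, c + e]) s y = 1.
  rewrite (@Rintegral_FTC2 _ _ _ _ (scaled_step c e))//.
    by rewrite scaled_step_ge// scaled_step_le// subr0.
  by apply: derivable_LRcontinuous; exact: derivable_scaled_step.
rewrite (@Rintegral_support _ `[c, c + e]%classic); last 2 first.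
- move=> y /=; rewrite /Omega/= !in_itv/= => /andP[y1 y2].
  by rewrite (le_trans c1 y1) (le_trans y2 ce1).
- move=> y _ /= /negP; rewrite in_itv/= negb_and -!ltNge => /orP yc.
  by rewrite /s derive_scaled_step_out// mulr0.
have iw := within_continuous_integrable (within_continuousM cw' cs).
have is1 := within_continuous_integrable cs.
have -> : w c = \int[mu]_(y in `[c, c + e]) (w c * s y).
  by rewrite RintegralZl// s1 mulr1.
have iwc : mu.-integrable `[c, c + e] (EFin \o (fun y => w c * s y)).
  apply: within_continuous_integrable; apply: within_continuousM => //.
  by apply: continuous_subspaceT => ?; exact: cvg_cst.
rewrite -RintegralB//.
have cd : {within `[c, c + e], continuous (fun y => w y * s y - w c * s y)}.
  apply: (within_continuousB (within_continuousM cw' cs)).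
  apply: within_continuousM => //.
  by apply: continuous_subspaceT => ?; exact: cvg_cst.
rewrite (le_trans (le_normr_Rintegral _ _))//.
  exact: within_continuous_integrable.
apply: (@le_trans _ _ (\int[mu]_(y in `[c, c + e]) (eta * (e^-1 * M)))).
  apply: le_Rintegral => //.
  - exact/within_continuous_integrable/within_continuous_normr.
  - apply: within_continuous_integrable.
    by apply: continuous_subspaceT => ?; exact: cvg_cst.
  move=> y /=; rewrite in_itv/= => yce.
  rewrite -mulrBl normrM ler_pM ?weta// /s derive_scaled_step normrM.
  by rewrite ger0_norm ?invr_ge0 ?(ltW e0)// ler_wpM2l ?invr_ge0 ?(ltW e0).
rewrite Rintegral_cst// fine_itv_measure ?(ltW ce)// addrAC subrr add0r.
by rewrite le_eqVlt; apply/orP; left; apply/eqP; field; rewrite gt_eqF.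
Qed.

End Mollifier.

(** * The fundamental theorem for weak derivatives *)

Section WeakDerivativeFTC.
Context {R : realType}.
Notation mu := (@lebesgue_measure R).
Implicit Types (w g : R -> R).

Definition plateau (a b e y : R) : R := scaled_step a e y - scaled_step b e y.

Lemma test_function_plateau (a b e : R) : 0 < e -> -1 < a -> a <= b -> b + e < 1 ->
  test_function (plateau a b e).
Proof.
move=> e0 a1 ab be; split.
  move=> n y; apply: Cn_derivable => m.
  have -> : plateau a b e = (fun y => scaled_step a e y + -1 * scaled_step b e y).
    by apply/funext => z; rewrite mulN1r.
  apply: CnD; first exact: Cn_scaled_step.
  by apply: CnM; [exact: Cn_cst|exact: Cn_scaled_step].
have supp : [set y | plateau a b e y != 0] `<=` `[a, b + e]%classic.
  move=> y /=; rewrite in_itv/=; apply: contraNT; rewrite negb_and -!ltNge /plateau.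
  move=> /orP[ya|yb].
    by rewrite !scaled_step_le ?subrr// ltW// (lt_le_trans ya).
  by rewrite !scaled_step_ge ?subrr// ltW// (le_lt_trans _ yb)// lerD2r.
apply: subset_trans (closure_subset supp) _.
rewrite -(closure_id _).1; last exact: interval_closed.
by move=> y /=; rewrite !in_itv/= => /andP[/(lt_le_trans a1) -> /le_lt_trans ->].
Qed.

Lemma scaled_step_cvg (c y : R) (e : nat -> R) : (forall n, 0 < e n) ->
  e n @[n --> \oo] --> 0 -> scaled_step c (e n) y @[n --> \oo] --> ((c < y)%R%:R : R).
Proof.
move=> e0 ecvg; have [cy|yc] := ltP c y; last first.
  by under eq_fun do rewrite scaled_step_le//; exact: cvg_cst.
apply: (@cvg_trans _ ((fun=> 1 : R) @ \oo)); last exact: cvg_cst.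
apply: near_eq_cvg; near=> n; rewrite scaled_step_ge//.
rewrite -lerBrDl; apply: ltW; near: n.
by apply: (cvgr_lt 0) => //; rewrite subr_gt0.
Unshelve. all: by end_near. Qed.

Lemma mollifier_cvg w (c : R) (e : nat -> R) :
  {within Omega R, continuous w} -> (forall n, 0 < e n) ->
  e n @[n --> \oo] --> 0 -> -1 < c -> (forall n, c + e n < 1) ->
  \int[mu]_(y in Omega R) (w y * (scaled_step c (e n))^`() y) @[n --> \oo] --> w c.
Proof.
move=> cw e0 ecvg c1 ce1; have [M M0 MP] := @mollifier_estimate R.
have c2 : c < 1 by rewrite (lt_trans _ (ce1 0%N))// ltrDl.
have wc : {for c, continuous w}.
  by apply: (within_continuous_continuous _ cw); [lra|rewrite in_itv/= c1].
apply/cvgrPdist_le => d d0.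
(* Chosen so that [eta * M <= d]; adding 1 covers [M = 0]. *)
pose eta := d / (M + 1); have eta0 : 0 < eta by rewrite divr_gt0// ltr_wpDl.
have [/= r0 r00 rP] := (cvgrPdist_le _ _).1 wc eta eta0.
near=> n; rewrite distrC.
rewrite (le_trans (MP w c (e n) eta cw (e0 n) (ltW c1) (ltW (ce1 n)) (ltW eta0)
  _))//.
  move=> y /andP[cy ye]; rewrite distrC; apply: rP => /=.
  rewrite distrC ger0_norm ?subr_ge0//.
  apply: (@le_lt_trans _ _ (e n)); first by rewrite lerBlDl.
  by near: n; apply: (cvgr_lt 0).
by rewrite /eta mulrAC ler_pdivrMr ?ltr_wpDl// ler_wpM2l ?(ltW d0)// lerDl.
Unshelve. all: by end_near. Qed.

(** Testing with [plateau a b e] as [e] tends to 0: the side with [w] tends to [w a - w b] by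
    mollification, the side with [g] to minus the integral over []a, b]] by dominated
    convergence. *)
Lemma weak_derivative_FTC_oo w g (a b : R) : {within Omega R, continuous w} ->
  mu.-integrable (Omega R) (EFin \o g) -> is_weak_derivative w g ->
  -1 < a -> a < b -> b < 1 -> \int[mu]_(y in `[a, b]) g y = w b - w a.
Proof.
move=> cw ig wg a1 ab b1.
(* Widths tending to 0 that keep the falling edge of the plateau, on [[b, b + e n]], inside the open
   interval. *)
pose e n : R := (1 - b) * n.+2%:R^-1.
have b10 : 0 < 1 - b by rewrite subr_gt0.
have e0 n : 0 < e n by rewrite mulr_gt0.
have be n : b + e n < 1.
  by rewrite -ltrBrDl /e -[ltRHS]mulr1 ltr_pM2l// invf_lt1// ltr1n.
have ae n : a + e n < 1 by rewrite (lt_trans _ (be n))// ltrD2r.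
have ecvg : e n @[n --> \oo] --> 0.
  rewrite -(mulr0 (1 - b)); apply: cvgM; first exact: cvg_cst.
  have -> : (fun n => n.+2%:R^-1) = [sequence (@harmonic R) n.+1]_n by [].
  by rewrite (cvg_shiftS (@harmonic R)); exact: cvg_harmonic.
have mO : measurable (Omega R) by exact: measurable_itv.
have L1 : \int[mu]_(y in Omega R) (w y * (plateau a b (e n))^`() y) @[n --> \oo] -->
    w a - w b.
  have iws c n : mu.-integrable (Omega R)
      (EFin \o (fun y => w y * (scaled_step c (e n))^`() y)).
    apply: within_continuous_integrable; apply: within_continuousM => //.
    by apply: continuous_subspaceT; exact: continuous_derive_scaled_step.
  have -> : (fun n => \int[mu]_(y in Omega R) (w y * (plateau a b (e n))^`() y)) =
    (fun n => \int[mu]_(y in Omega R) (w y * (scaled_step a (e n))^`() y) -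
              \int[mu]_(y in Omega R) (w y * (scaled_step b (e n))^`() y)).
    apply/funext => n; rewrite -RintegralB//; apply: eq_Rintegral => y _.
    rewrite -mulrBr; congr (_ * _); rewrite !derive1E.
    by apply: deriveB; exact: derivable_scaled_step.
  by apply: cvgB; apply: mollifier_cvg => //; exact: lt_trans ab.
(* The indicator function of []a, b]], the pointwise limit of the plateaus. *)
pose chi y : R := (a < y)%R%:R - (b < y)%R%:R.
have mg : measurable_fun (Omega R) g by move/integrableP : ig => [/measurable_EFinP].
have mp n : measurable_fun (Omega R) (plateau a b (e n)).
  apply: measurable_funTS; apply: continuous_measurable_fun => y.
  apply: cvgB; apply/differentiable_continuous/derivable1_diffP;
    exact: derivable_scaled_step.
have L2 : \int[mu]_(y in Omega R) (g y * plateau a b (e n) y) @[n --> \oo] -->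
    \int[mu]_(y in Omega R) (g y * chi y).
  have gchi y : g y * plateau a b (e n) y @[n --> \oo] --> g y * chi y.
    apply: cvgM; first exact: cvg_cst.
    by apply: cvgB; exact: scaled_step_cvg.
  have dom n y : `|g y * plateau a b (e n) y| <= `|g y|.
    rewrite normrM -[leRHS]mulr1 ler_wpM2l// /plateau.
    have /andP[s1 s2] := scaled_step_itv a (e n) y.
    have /andP[s3 s4] := scaled_step_itv b (e n) y.
    by rewrite ler_norml; apply/andP; split; lra.
  have mgp n : measurable_fun (Omega R) (fun y => (g y * plateau a b (e n) y)%:E).
    by apply/measurable_EFinP; exact: measurable_funM.
  have mgc : measurable_fun (Omega R) (fun y => (g y * chi y)%:E).
    apply/measurable_EFinP; apply: (measurable_fun_cvg
      (h := fun n y => g y * plateau a b (e n) y)) => [n|y _]; last exact: gchi.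
    exact: measurable_funM.
  have gchiE y : (g y * plateau a b (e n) y)%:E @[n --> \oo] --> (g y * chi y)%:E.
    by apply: cvg_EFin; [exact: nearW|exact: gchi].
  have [|||igc _ lim] := @dominated_convergence _ _ _ mu _ mO
    (fun n y => (g y * plateau a b (e n) y)%:E) (fun y => (g y * chi y)%:E)
    (fun y => (`|g y|)%:E) mgp mgc.
  - by apply: aeW => y _; exact: gchiE.
  - exact: integrable_abse ig.
  - by apply: aeW => y n _; rewrite lee_fin.
  by rewrite /Rintegral; apply: fine_cvg; rewrite fineK//; exact: integrable_fin_num.
have W n : \int[mu]_(y in Omega R) (w y * (plateau a b (e n))^`() y) =
    - \int[mu]_(y in Omega R) (g y * plateau a b (e n) y).
  by apply: wg; apply: test_function_plateau => //; exact: ltW.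
have E : \int[mu]_(y in Omega R) (g y * chi y) = w b - w a.
  have LN : (- \int[mu]_(y in Omega R) (g y * plateau a b (e n) y)) @[n --> \oo] -->
    (- \int[mu]_(y in Omega R) (g y * chi y)) by exact: cvgN L2.
  have := L1; under eq_fun do rewrite W.
  move=> /(cvg_unique (@Rhausdorff R) LN) /eqP.
  by rewrite -eqr_opp opprK opprB => /eqP.
rewrite -E [RHS](@Rintegral_support _ `]a, b]%classic); last 2 first.
- move=> y; rewrite /Omega/= !in_itv/= => /andP[ay yb].
  by rewrite (ltW (lt_trans a1 ay)) (ltW (le_lt_trans yb b1)).
- move=> y _ /= /negP; rewrite in_itv/= negb_and -leNgt -ltNge /chi => /orP[ya|yb].
    by rewrite !ltNge ya (le_trans ya (ltW ab))/= subrr mulr0.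
  by rewrite yb (lt_trans ab yb) subrr mulr0.
rewrite -Rintegral_itv_obnd_cbnd; last first.
  apply: integrableS ig => //; move=> y; rewrite /Omega/= !in_itv/= => /andP[ay yb].
  by rewrite (ltW (lt_trans a1 ay)) (ltW (le_lt_trans yb b1)).
apply: eq_Rintegral => y /set_mem/=; rewrite in_itv/= /chi => /andP[-> yb].
by rewrite ltNge yb/= subr0 mulr1.
Qed.

End WeakDerivativeFTC.

(** * Integrals and continuous functions on the closed interval *)

Section W12OnOmega.
Context {R : realType}.
Notation mu := (@lebesgue_measure R).
Implicit Types (f g w q : R -> R) (a b : R).

Lemma measurable_Omega : measurable (Omega R).
Proof. exact: measurable_itv. Qed.

Lemma itv_subset_Omega a b (b0 b1 : bool) : -1 <= a -> b <= 1 ->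
  [set` Interval (BSide b0 a) (BSide b1 b)] `<=` Omega R.
Proof.
move=> a1 b1' y; rewrite /Omega/= !in_itv/=.
by case: b0; case: b1 => /= /andP[ay yb]; apply/andP; split; lra.
Qed.

Lemma integrable_itv f a b (b0 b1 : bool) : mu.-integrable (Omega R) (EFin \o f) ->
  -1 <= a -> b <= 1 ->
  mu.-integrable [set` Interval (BSide b0 a) (BSide b1 b)] (EFin \o f).
Proof.
move=> fi a1 b1'; apply: integrableS fi.
- exact: measurable_Omega.
- exact: measurable_itv.
- exact: itv_subset_Omega.
Qed.

Lemma Rintegral_itv_sub f a b : mu.-integrable (Omega R) (EFin \o f) ->
  -1 <= a -> a <= b -> b <= 1 -> \int[mu]_(y in `[a, b]) f y =
  \int[mu]_(y in `[-1, b]) f y - \int[mu]_(y in `[-1, a]) f y.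
Proof.
move=> fi a1 ab b1; rewrite Rintegral_itvB ?bnd_simp//.
  by rewrite Rintegral_itv_obnd_cbnd//; exact: integrable_itv.
exact: integrable_itv.
Qed.

Lemma within_continuous_eq_cst w (c : R) : {within Omega R, continuous w} ->
  (forall x : R, -1 < x < 1 -> w x = c) -> forall x : R, -1 <= x <= 1 -> w x = c.
Proof.
have N11 : (-1 : R) < 1 by lra.
move=> /(continuous_within_itvP _ N11)[_ w0 w1] wc x.
rewrite [X in X && _]le_eqVlt [X in _ && X]le_eqVlt.
case/andP => /predU1P[<- _|x1 /predU1P[->|x2]]; last by apply: wc; rewrite x1.
- apply: (cvg_unique (@Rhausdorff R) w0).
  apply: (@cvg_trans _ ((fun=> c) @ (-1 : R)^'+)); last exact: cvg_cst.
  apply: near_eq_cvg; near=> y; rewrite wc//; apply/andP; split => //.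
- apply: (cvg_unique (@Rhausdorff R) w1).
  apply: (@cvg_trans _ ((fun=> c) @ (1 : R)^'-)); last exact: cvg_cst.
  apply: near_eq_cvg; near=> y; rewrite wc//; apply/andP; split => //.
Unshelve. all: by end_near. Qed.

(** On the open interval [w] differs from the primitive [P] of [g] by a constant; continuity of both
    extends this to the end points. *)
Lemma weak_derivative_FTC w g a b : {within Omega R, continuous w} ->
  mu.-integrable (Omega R) (EFin \o g) -> is_weak_derivative w g ->
  -1 <= a -> a <= b -> b <= 1 -> \int[mu]_(y in `[a, b]) g y = w b - w a.
Proof.
move=> cw ig wg a1 ab b1.
pose P x := parameterized_integral mu (-1) x g.
have cD : {within Omega R, continuous (w - P)}.
  by apply: within_continuousB => //; apply: parameterized_integral_continuous.
have DP x y : -1 < x -> x < y -> y < 1 -> (w - P) y = (w - P) x.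
  move=> x1 xy y1; have := weak_derivative_FTC_oo cw ig wg x1 xy y1.
  rewrite Rintegral_itv_sub ?(ltW x1) ?(ltW xy) ?(ltW y1)//.
  by rewrite !fctE /P /parameterized_integral; lra.
have D0 x : -1 <= x <= 1 -> (w - P) x = (w - P) 0.
  apply: within_continuous_eq_cst => // y /andP[y1 y2].
  have [y0|y0|->//] := ltgtP y 0; first by rewrite -(DP y 0)//; lra.
  by rewrite (DP 0 y)//; lra.
rewrite Rintegral_itv_sub//.
have := D0 a; have := D0 b; rewrite !fctE /P /parameterized_integral.
rewrite a1 b1 (le_trans a1 ab) (le_trans ab b1) => /(_ isT) Hb /(_ isT) Ha.
lra.
Qed.

(** Lebesgue differentiation of the extension by zero: its primitive from [-oo] vanishes
    identically, and its derivative is almost everywhere the integrand. *)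
Lemma integrable_ae_eq0 f : mu.-integrable (Omega R) (EFin \o f) ->
  (forall x : R, -1 <= x <= 1 -> \int[mu]_(y in `[-1, x]) f y = 0) ->
  {ae mu, forall x, Omega R x -> f x = 0}.
Proof.
move=> fi f0; have mO := measurable_Omega.
have Fi : mu.-integrable setT (EFin \o (f \_ (Omega R))).
  by move: fi; rewrite integrable_mkcond//= restrict_EFin.
have Fi' y : mu.-integrable `]-oo, y] (EFin \o (f \_ (Omega R))).
  by apply: integrableS Fi.
have Floc : locally_integrable setT (f \_ (Omega R)) by exact: integrable_locally.
have := FTC1Ny Fi' Floc.
apply: filterS; first exact: (ae_filter_ringOfSetsType mu).
move=> x [_ + Ox].
rewrite patchE mem_set// => <-.
have -> : (fun x => \int[mu]_(t in `]-oo, x]) (f \_ (Omega R)) t) = fun=> 0.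
  apply/funext => y; rewrite -Rintegral_mkcondr.
  have [y1|y1] := ltP y (-1).
    have -> : `]-oo, y]%classic `&` Omega R = set0.
      rewrite -subset0 => z []; rewrite /Omega/= !in_itv/= => zy /andP[z1 _].
      by move: (le_lt_trans zy y1); rewrite ltNge z1.
    by rewrite Rintegral_set0.
  have -> : `]-oo, y]%classic `&` Omega R = `[-1, Num.min y 1]%classic.
    apply/seteqP; split => z; rewrite /Omega/= !in_itv/= le_min.
      by move=> [-> /andP[-> ->]].
    by move=> /andP[-> /andP[-> ->]].
  by apply: f0; rewrite le_min ge_min y1 lexx orbT/=; lra.
exact: derive1_cst.
Qed.

(** Domination by [1 + g^2], integrable because [Omega] has finite measure. *)
Lemma square_integrable_integrable g : square_integrable g ->
  mu.-integrable (Omega R) (EFin \o g).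
Proof.
move=> [mg ig]; have mO := measurable_Omega.
have i1 : mu.-integrable (Omega R) (EFin \o (fun=> 1 : R)).
  apply: within_continuous_integrable.
  by apply: continuous_subspaceT => ?; exact: cvg_cst.
have i2 := @integrableD _ _ _ mu _ mO _ _ i1 ig.
apply: (@le_integrable _ _ _ mu _ mO _ _ _ _ i2); first exact/measurable_EFinP.
move=> y _ /=; rewrite lee_fin [leRHS]ger0_norm ?addr_ge0 ?sqr_ge0//.
rewrite -(real_normK (num_real (g y))).
by have := sqr_ge0 (`|g y| - 1); have := normr_ge0 (g y); rewrite sqrrB1; lra.
Qed.

Lemma within_continuous_square_integrable w : {within Omega R, continuous w} ->
  square_integrable w.
Proof.
move=> cw; split; last first.
  apply: (@within_continuous_integrable _ _ _ (fun y => w y ^+ 2)).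
  exact: within_continuousM.
by have /measurable_int/measurable_EFinP := within_continuous_integrable cw.
Qed.

(** Otherwise there are pairs at distance less than [1 / (n + 1)] whose values differ by more than
    [eps]. Both components tend along [ultraN] to the same point of [Omega], where [q] is
    continuous. *)
Lemma within_continuous_unif q (eps : R) : {within Omega R, continuous q} -> 0 < eps ->
  exists2 d : R, 0 < d & forall x y : R, -1 <= x <= 1 -> -1 <= y <= 1 ->
    `|x - y| < d -> `|q x - q y| <= eps.
Proof.
move=> /subspace_continuousP cq eps0; apply: contrapT => H.
have /choice[z zP] n : exists z : R * R, [/\ -1 <= z.1 <= 1, -1 <= z.2 <= 1,
    `|z.1 - z.2| < n.+1%:R^-1 & eps < `|q z.1 - q z.2|].
  apply: contrapT => Hn; apply: H; exists n.+1%:R^-1; first by rewrite invr_gt0.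
  move=> x y x1 y1 xy; rewrite leNgt; apply/negP => qxy.
  by apply: Hn; exists (x, y).
have zB n : `|(z n).1| <= 1 by have [? _ _ _] := zP n; rewrite ler_norml.
have z1 := ulimP zB; set l := ulim _ in z1.
have z2 : (z n).2 @[n --> ultraN] --> l.
  have -> : (fun n => (z n).2) = (fun n => (z n).1 - ((z n).1 - (z n).2)).
    by apply/funext => n; rewrite subKr.
  rewrite -[l]subr0; apply: cvgB => //; apply: norm_cvg0.
  apply: (@squeeze_cvgr _ ultraN _ R (fun=> 0) (fun n => n.+1%:R^-1)).
  - by apply: nearW => n; have [_ _ /ltW -> _] := zP n; rewrite normr_ge0.
  - exact: cvg_cst.
  - by apply: cvg_trans (@cvg_harmonic R) => A /ultraN_oo.
have lO : Omega R l.
  rewrite /Omega/= in_itv/= -ler_norml.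
  by apply: (cvgr_to_le (cvg_norm z1)); exact: nearW.
have qz (s : nat -> R) : (forall n, -1 <= s n <= 1) -> s n @[n --> ultraN] --> l ->
    q (s n) @[n --> ultraN] --> q l.
  move=> sO sl; apply: cvg_trans (cq l lO) => A /= /sl.
  apply: (@filterS _ ultraN _ (fun n => Omega R (s n) -> A (q (s n)))) => n.
  by apply; rewrite /Omega/= in_itv/=.
have q1 : q (z n).1 @[n --> ultraN] --> q l by apply: qz => // n; case: (zP n).
have q2 : q (z n).2 @[n --> ultraN] --> q l by apply: qz => // n; case: (zP n).
have q0 : `|q (z n).1 - q (z n).2| @[n --> ultraN] --> (0 : R).
  rewrite -(normr0 R) -(subrr (q l)); exact: cvg_norm (cvgB q1 q2).
have : eps <= 0.
  by apply: (cvgr_to_ge q0); apply: nearW => n; have [_ _ _ /ltW] := zP n.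
by rewrite leNgt eps0.
Qed.

End W12OnOmega.

(** * Classical derivatives as weak derivatives, and uniqueness *)

Section WeakDerivatives.
Context {R : realType}.
Notation mu := (@lebesgue_measure R).
Implicit Types (u v w g : R -> R).

Lemma weak_derivativeP w : W12 w ->
  square_integrable (weak_derivative w) /\ is_weak_derivative w (weak_derivative w).
Proof.
by move=> [_ [g gP]]; apply: (@xgetPex _ (fun=> 0)
  [set g | square_integrable g /\ is_weak_derivative w g]); exists g.
Qed.

(** Integration by parts; the boundary terms vanish because the support of a test function avoids
    the end points. *)
Lemma C1_is_weak_derivative u v : {within Omega R, continuous u} ->
  {within Omega R, continuous v} ->
  (forall x : R, -1 < x < 1 -> is_derive x 1 u (v x)) -> is_weak_derivative u v.
Proof.
move=> cu cv duv phi [sphi supp].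
have N11 : (-1 : R) < 1 by lra.
have phi0 (x : R) : ~ (-1 < x < 1) -> phi x = 0.
  move=> x1; apply/eqP/negPn/negP => phix; apply: x1.
  by have := supp x (@subset_closure _ [set y | phi y != 0] _ phix); rewrite /= in_itv.
have dphi y : derivable phi y 1 by exact: (sphi 0%N).
have cphi' : continuous phi^`().
  by move=> y; apply/differentiable_continuous/derivable1_diffP; exact: (sphi 1%N).
have [_ u0 u1] := (continuous_within_itvP u N11).1 cu.
rewrite /Omega (@Rintegration_by_parts _ u phi v phi^`())//.
- by rewrite !phi0 ?ltxx ?andbF// !mulr0 subrr sub0r.
- split=> // x; rewrite in_itv/= => /duv; by case.
- by move=> x; rewrite in_itv/= => /duv [_ <-]; rewrite derive1E.
- exact: continuous_subspaceT.
- exact: derivable_LRcontinuous.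
Qed.

Lemma C1_W12_continuous u v : {within Omega R, continuous u} ->
  {within Omega R, continuous v} ->
  (forall x : R, -1 < x < 1 -> is_derive x 1 u (v x)) -> W12_continuous u.
Proof.
move=> cu cv duv; split=> //; split; first exact: within_continuous_square_integrable.
exists v; split; first exact: within_continuous_square_integrable.
exact: C1_is_weak_derivative.
Qed.

(** Both integrate to the increments of [w], so the difference has zero integral over every
    [[-1, x]]. *)
Lemma weak_derivative_ae_unique w g1 g2 : {within Omega R, continuous w} ->
  mu.-integrable (Omega R) (EFin \o g1) -> mu.-integrable (Omega R) (EFin \o g2) ->
  is_weak_derivative w g1 -> is_weak_derivative w g2 ->
  {ae mu, forall x, Omega R x -> g1 x = g2 x}.
Proof.
move=> cw i1 i2 w1 w2.
have i12 : mu.-integrable (Omega R) (EFin \o (fun x => g1 x - g2 x)).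
  exact: (@integrableB _ _ _ mu _ measurable_Omega _ _ i1 i2).
have := integrable_ae_eq0 i12.
have E x : -1 <= x <= 1 -> \int[mu]_(y in `[-1, x]) (g1 y - g2 y) = 0.
  move=> /andP[x1 x2]; rewrite RintegralB//; [|exact: integrable_itv..].
  rewrite (weak_derivative_FTC cw i1 w1)// (weak_derivative_FTC cw i2 w2)//.
  by rewrite subrr.
move=> /(_ E); apply: filterS; first exact: (ae_filter_ringOfSetsType mu).
by move=> x H /H /eqP; rewrite subr_eq0 => /eqP.
Qed.

End WeakDerivatives.

(** * Energies of continuous and discrete paths *)

Section EnergyOfPaths.
Context {R : realType} {I : finType}.
Notation mu := (@lebesgue_measure R).
Variables (al : I -> R) (f : (I -> R) -> R).
Hypothesis al_gt0 : forall k, 0 < al k.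
Hypothesis f_lip : loclip f.
Implicit Types (w g : I -> R -> R).

Definition path_energy w : R := \int[mu]_(y in Omega R)
  density al f (w ^~ y) (fun k => weak_derivative (w k) y).

Lemma integrable_sumr (D : set R) (r : seq I) (h : I -> R -> R) :
  measurable D -> (forall k, mu.-integrable D (EFin \o h k)) ->
  mu.-integrable D (EFin \o (fun y => \sum_(k <- r) h k y)).
Proof.
move=> mD hi; have -> : EFin \o (fun y => \sum_(k <- r) h k y) =
    (fun y => \sum_(k <- r) (h k y)%:E)%E.
  by apply/funext => y; rewrite /= sumEFin.
by apply: (@integrable_sum _ _ _ mu _ mD) => k _; exact: hi.
Qed.

Lemma Rintegral_sumr (D : set R) (r : seq I) (h : I -> R -> R) :
  measurable D -> (forall k, mu.-integrable D (EFin \o h k)) ->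
  \int[mu]_(y in D) (\sum_(k <- r) h k y) = \sum_(k <- r) \int[mu]_(y in D) h k y.
Proof.
move=> mD hi; elim: r => [|k r IHr].
  by under eq_Rintegral do rewrite big_nil; rewrite Rintegral_cst// mul0r big_nil.
under eq_Rintegral do rewrite big_cons.
by rewrite big_cons RintegralD ?IHr//; exact: integrable_sumr.
Qed.

Lemma integrable_cstr (D : set R) (c : R) : measurable D -> D `<=` Omega R ->
  mu.-integrable D (EFin \o (fun=> c)).
Proof.
move=> mD DO; have iO : mu.-integrable (Omega R) (EFin \o (fun=> c)).
  apply: within_continuous_integrable.
  by apply: continuous_subspaceT => ?; exact: cvg_cst.
exact: (@integrableS _ _ _ mu _ _ _ measurable_Omega).
Qed.

Lemma integrableZr (D : set R) (c : R) (h : R -> R) : measurable D ->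
  mu.-integrable D (EFin \o h) -> mu.-integrable D (EFin \o (fun y => c * h y)).
Proof. by move=> mD hi; apply: (@integrableZl _ _ _ mu _ mD c _ hi). Qed.

Lemma within_continuous_loclip w : (forall k, {within Omega R, continuous (w k)}) ->
  {within Omega R, continuous (fun y => f (w ^~ y))}.
Proof.
move=> cw; apply/subspace_continuousP => x Ox; apply: loclip_cvg => // k.
by have /subspace_continuousP := cw k; exact.
Qed.

Lemma integrable_density w g : (forall k, {within Omega R, continuous (w k)}) ->
  (forall k, square_integrable (g k)) ->
  mu.-integrable (Omega R) (EFin \o (fun y => density al f (w ^~ y) (g ^~ y))).
Proof.
move=> cw gi; have mO := @measurable_Omega R.
apply: (@integrableD _ _ _ mu _ mO (EFin \o _) (EFin \o _)).
  by apply: integrable_sumr => // k; apply: integrableZr => //; case: (gi k).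
exact/within_continuous_integrable/within_continuous_loclip.
Qed.

(** The weak derivative chosen in the energy agrees almost everywhere with the classical one,
    simultaneously for the finitely many components. *)
Lemma path_energy_classical w g : (forall k, {within Omega R, continuous (w k)}) ->
  (forall k, {within Omega R, continuous (g k)}) ->
  (forall k (x : R), -1 < x < 1 -> is_derive x 1 (w k) (g k x)) ->
  path_energy w = \int[mu]_(y in Omega R) density al f (w ^~ y) (g ^~ y).
Proof.
move=> cw cg dwg; have mO := @measurable_Omega R.
have wdP k := weak_derivativeP (C1_W12_continuous (cw k) (cg k) (dwg k)).1.
have gs k := within_continuous_square_integrable (cg k).
have mdens g' (gs' : forall k, square_integrable (g' k)) :
    measurable_fun (Omega R) (fun y => (density al f (w ^~ y) (g' ^~ y))%:E).
  exact: measurable_int (integrable_density cw gs').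
congr fine; apply: (@ae_eq_integral _ _ _ mu) => //.
- by apply: mdens => k; case: (wdP k).
- exact: mdens.
have : {ae mu, forall x, forall k, Omega R x -> weak_derivative (w k) x = g k x}.
  apply: (@filter_forall _ _ _ _ (ae_filter_ringOfSetsType mu)) => k.
  have [wds wdw] := wdP k.
  apply: (weak_derivative_ae_unique (cw k)) => //.
  - exact: square_integrable_integrable.
  - exact: square_integrable_integrable.
  - exact: C1_is_weak_derivative.
apply: filterS; first exact: (ae_filter_ringOfSetsType mu).
by move=> x H Ox; congr (density _ _ _ _)%:E; apply/funext => k; exact: H.
Qed.

Section LowerBound.
Variables (w g : I -> R -> R).
Hypothesis cw : forall k, {within Omega R, continuous (w k)}.
Hypothesis gs : forall k, square_integrable (g k).
Hypothesis wg : forall k, is_weak_derivative (w k) (g k).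

(* [(g - m)^2 >= 0] with [m] the mean slope of [w] on the cell. *)
Lemma denergy_cell_le_integral (a h eps : R) : -1 <= a -> 0 < h -> a + h <= 1 ->
  (forall y, a <= y <= a + h -> `|f (w ^~ a) - f (w ^~ y)| <= eps) ->
  denergy_cell al f h (w ^~ a) (w ^~ (a + h)) <=
  \int[mu]_(y in `[a, (a + h)]) (density al f (w ^~ y) (g ^~ y) + eps).
Proof.
move=> a1 h0 ah feps; set D : set R := `[a, a + h]%classic.
have mD : measurable D by exact: measurable_itv.
have DO : D `<=` Omega R by exact: itv_subset_Omega.
have aah : a <= a + h by rewrite lerDl ltW.
have gi k : mu.-integrable D (EFin \o g k).
  exact/integrable_itv/ah/a1/square_integrable_integrable.
pose m k := (w k (a + h) - w k a) / h.
(* The tangent at the mean slope [m k] to the convex function [al / 2 * g^2]; its integral over the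
   cell is exactly the discrete gradient energy. *)
pose t k y := al k * m k * g k y + - (al k / 2 * m k ^+ 2).
have ci c : mu.-integrable D (EFin \o (fun=> c)) by exact: integrable_cstr.
have gzi k : mu.-integrable D (EFin \o (fun y => al k * m k * g k y)).
  exact: integrableZr.
have ti k : mu.-integrable D (EFin \o t k).
  exact: (@integrableD _ _ _ mu _ mD _ _ (gzi k) (ci _)).
have tI k : \int[mu]_(y in D) t k y = al k * (w k (a + h) - w k a) ^+ 2 / (2 * h).
  rewrite RintegralD// RintegralZl// Rintegral_cst// fine_itv_measure//.
  rewrite (weak_derivative_FTC (@cw k) _ (@wg k))//; last first.
    exact: square_integrable_integrable.
  by rewrite /m; field; rewrite gt_eqF.
have -> : denergy_cell al f h (w ^~ a) (w ^~ (a + h)) =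
    \int[mu]_(y in D) (\sum_k t k y + f (w ^~ a)).
  rewrite RintegralD//; last exact: integrable_sumr.
  rewrite Rintegral_sumr// Rintegral_cst// fine_itv_measure//.
  rewrite /denergy_cell mulr_suml; congr (_ + _).
    by apply: eq_bigr => k _; rewrite tI.
  by rewrite mulrC; congr (_ * _); rewrite addrAC subrr add0r.
apply: le_Rintegral => //.
- apply: (@integrableD _ _ _ mu _ mD (EFin \o _) (EFin \o _)) => //.
  exact: integrable_sumr.
- apply: (@integrableD _ _ _ mu _ mD (EFin \o _) (EFin \o _)) => //.
  exact/integrable_itv/ah/a1/integrable_density.
move=> y; rewrite /D/= in_itv/= => yah; rewrite /density -addrA lerD//.
  apply: ler_sum => k _; rewrite -subr_ge0.
  have -> : al k / 2 * g k y ^+ 2 - t k y = al k / 2 * (g k y - m k) ^+ 2.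
    by rewrite /t; field.
  by rewrite mulr_ge0 ?sqr_ge0// divr_ge0// ltW.
by rewrite -lerBlDl (le_trans (ler_norm _))// feps.
Qed.

(** Cell estimates are added up. By uniform continuity of [f] along [w], fine grids make the
    sampling error at most [eps] pointwise, hence [eps * 2] over [Omega]. *)
Lemma denergy_le_integral (eps : R) : 0 < eps -> \forall n \near \oo,
  denergy al f n.+1 (fun i k => w k (-1 + i%:R * mesh n.+1)) <=
  \int[mu]_(y in Omega R) density al f (w ^~ y) (g ^~ y) + eps * 2.
Proof.
move=> eps0.
have [d d0 dP] := within_continuous_unif (within_continuous_loclip (@cw)) eps0.
have hcvg : mesh n.+1 @[n --> \oo] --> (0 : R).
  rewrite -(mulr0 2); apply: cvgM; first exact: cvg_cst.
  exact: cvg_harmonic.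
near=> n.
have hd : mesh n.+1 < d by near: n; apply: (cvgr_lt 0).
set h : R := mesh n.+1; have h0 : 0 < h by exact: mesh_gt0.
pose F y := density al f (w ^~ y) (g ^~ y) + eps.
have Fi : mu.-integrable (Omega R) (EFin \o F).
  apply: (@integrableD _ _ _ mu _ measurable_Omega (EFin \o _) (EFin \o _)).
    exact: integrable_density.
  exact: (integrable_cstr _ measurable_Omega).
have node1' i : (i <= n.+1)%N -> -1 + i%:R * h <= 1.
  move=> iN; suff : i%:R * h <= 2 by lra.
  by rewrite -(@mulr_mesh R n.+1)// ler_pM2r// ler_nat.
have step i : (i <= n.+1)%N -> \sum_(0 <= j < i) denergy_cell al f h
      (fun k => w k (-1 + j%:R * h)) (fun k => w k (-1 + j.+1%:R * h)) <=
    \int[mu]_(y in `[-1, (-1 + i%:R * h)]) F y.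
  elim: i => [_|i IHi iN].
    by rewrite big_geq// mul0r addr0 set_itv1 Rintegral_set1.
  have i0 : 0 <= i%:R * h by rewrite mulr_ge0// ltW.
  have iS : -1 + i.+1%:R * h = -1 + i%:R * h + h by rewrite -natr1; ring.
  have iS1 : -1 + i%:R * h + h <= 1 by rewrite -iS node1'.
  rewrite big_nat_recr//= iS.
  have -> : \int[mu]_(y in `[-1, (-1 + i%:R * h + h)]) F y =
      \int[mu]_(y in `[-1, (-1 + i%:R * h)]) F y +
      \int[mu]_(y in `[(-1 + i%:R * h), (-1 + i%:R * h + h)]) F y.
    rewrite (@Rintegral_itv_sub _ F (-1 + i%:R * h))//; last 2 first.
    - by rewrite lerDl.
    - by rewrite lerDl ltW.
    by rewrite [RHS]addrC subrK.
  rewrite lerD ?IHi//; first exact: ltnW.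
  apply: denergy_cell_le_integral => //; first by rewrite lerDl.
  move=> y /andP[y1 y2]; apply: dP.
  - by rewrite lerDl i0 node1'// ltnW.
  - by rewrite (le_trans _ y1) ?lerDl// (le_trans y2).
  - rewrite distrC ger0_norm ?subr_ge0//; apply: le_lt_trans hd.
    by rewrite lerBlDl.
have := step n.+1 (leqnn _); rewrite mulr_mesh//.
have -> : -1 + 2 = 1 :> R by lra.
move=> /le_trans; apply; rewrite -/(Omega R).
rewrite (@RintegralD _ _ _ mu _ _ _ (@measurable_Omega R)); last 2 first.
- exact: integrable_density.
- exact: (integrable_cstr _ measurable_Omega).
have mO : fine (mu (Omega R)) = 2 by rewrite fine_itv_measure; lra.
by rewrite (@Rintegral_cst _ _ _ mu _ (@measurable_Omega R)) mO.
Unshelve. all: by end_near. Qed.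

End LowerBound.

End EnergyOfPaths.

(** * Existence and regularity of a minimiser *)

Section SmoothMinimiser.
Context {R : realType} {I : finType}.
Notation mu := (@lebesgue_measure R).
Variables (al : I -> R) (f : (I -> R) -> R) (df : I -> (I -> R) -> R) (K : R).
Hypothesis al_gt0 : forall k, 0 < al k.
Hypothesis f_ge : forall x, - K <= f x.
Hypothesis f_lip : loclip f.
Hypothesis df_lip : forall k, loclip (df k).
Hypothesis f_der : forall x k, exists C : R, forall t, `|t| <= 1 ->
  f (fun j => if j == k then x j + t else x j) <= f x + t * df k x + C * t ^+ 2.

Lemma lipschitz_within_continuous (F : R -> R) :
  lipschitz_on_Omega F -> {within Omega R, continuous F}.
Proof.
move=> [L FL]; apply/subspace_continuousP => x; rewrite /Omega/= in_itv/= => xO.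
have FL' y : -1 <= y <= 1 -> `|F x - F y| <= (`|L| + 1) * `|x - y|.
  wlog xy : x y xO / x <= y.
    move=> H yO; have [xy|/ltW yx] := leP x y; first exact: H.
    by rewrite distrC [`|x - y|]distrC H.
  move=> yO; rewrite distrC [`|x - y|]distrC (le_trans (FL x y _ xy _))//.
  - by case/andP: xO.
  - by case/andP: yO.
  - rewrite [`|y - x|]ger0_norm ?subr_ge0// ler_wpM2r ?subr_ge0//.
    by rewrite (le_trans (ler_norm _))// lerDl.
apply/cvgrPdist_le => eps eps0; rewrite near_withinE; near=> y => /=.
rewrite in_itv/= => yO; rewrite (le_trans (FL' _ yO))// mulrC.
rewrite -ler_pdivlMr ?ltr_wpDl//.
near: y; apply: cvgr_dist_le; first exact: cvg_id.
by rewrite divr_gt0// ltr_wpDl.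
Unshelve. all: by end_near. Qed.

Lemma within_Omega_for (F : R -> R) (x : R) : {within Omega R, continuous F} ->
  -1 < x < 1 -> {for x, continuous F}.
Proof.
move=> cF x1; apply: (within_continuous_continuous _ cF); last by rewrite in_itv.
by lra.
Qed.

Lemma near_Omega (x : R) : -1 < x < 1 -> \forall y \near x, -1 < y < 1.
Proof.
move=> x1; have xI : x \in `]-1, 1[ by rewrite in_itv.
by apply: filterS (near_in_itvoo xI) => y; rewrite in_itv.
Qed.

(** Near each interior point [u'] coincides with [v], so the derivative of [v] is that of [u'];
    continuity of [u''] comes from [k]. *)
Lemma C2_second_derivative (u v k : R -> R) : {within Omega R, continuous u} ->
  {within Omega R, continuous k} ->
  (forall x : R, -1 < x < 1 -> is_derive x 1 u (v x) /\ is_derive x 1 v (k x)) ->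
  C2_interior u /\ forall x : R, -1 < x < 1 -> u^`(2) x = k x.
Proof.
move=> cu ck duv.
have u1 (x : R) : -1 < x < 1 -> \forall y \near x, v y = u^`() y.
  move=> /near_Omega; apply: filterS => y /duv[[_ +] _].
  by rewrite derive1E.
have u2 (x : R) : -1 < x < 1 -> is_derive x 1 u^`() (k x).
  by move=> x1; apply: near_eq_is_derive (u1 x x1) (duv x x1).2.
have u2E (x : R) : -1 < x < 1 -> u^`(2) x = k x.
  by move=> /u2[_ <-]; rewrite derive1nS derive1n1 derive1E.
split=> //; split=> // x x1; split.
- by case: (duv x x1) => -[].
- by case: (u2 x x1).
- have kx := within_Omega_for ck x1.
  rewrite /prop_for /continuous_at u2E//; apply: cvg_trans kx.
  apply: near_eq_cvg; have := near_Omega x1; apply: filterS => y y1.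
  by rewrite u2E.
Qed.

Theorem smooth_minimiser (a b : I -> R) : exists u : I -> R -> R,
  [/\ forall k, W12_continuous (u k),
      forall k, u k (-1) = a k /\ u k 1 = b k,
      forall w : I -> R -> R, (forall k, W12_continuous (w k)) ->
        (forall k, w k (-1) = a k /\ w k 1 = b k) ->
        path_energy al f u <= path_energy al f w
    & forall k, C2_interior (u k) /\
        forall x : R, -1 < x < 1 -> al k * (u k)^`(2) x = df k (u ^~ x)].
Proof.
have [u [v [e [uab uvL duv [e0 eL de] emin]]]] :=
  discrete_limit al_gt0 f_ge f_lip df_lip f_der a b.
have cu k : {within Omega R, continuous (u k)}.
  exact: lipschitz_within_continuous (uvL k).1.
have cv k : {within Omega R, continuous (v k)}.
  exact: lipschitz_within_continuous (uvL k).2.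
have du k (x : R) : -1 < x < 1 -> is_derive x 1 (u k) (v k x).
  by move=> x1; case: (duv k x x1).
have ce := lipschitz_within_continuous eL.
have cdens : {within Omega R, continuous (fun y => density al f (u ^~ y) (v ^~ y))}.
  apply/subspace_continuousP => x Ox.
  pose z (j : I + I) := match j with inl k => u k | inr k => v k end.
  apply: (loclip_cvg (loclip_density al f_lip) (s := fun y j => z j y)
    (x := z ^~ x)) => j.
  have cz : {within Omega R, continuous (z j)} by case: j.
  by have /subspace_continuousP := cz; exact.
have N11 : (-1 : R) < 1 by lra.
(* The limit [e] of the partial energies is a primitive of the continuous energy density of [u] and
   starts from 0. *)
have uE : path_energy al f u = e 1.
  rewrite (path_energy_classical al f_lip cu cv du).
  rewrite /Omega (@Rintegral_FTC2 _ _ _ _ e)// ?e0 ?subr0//.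
    have [_ e1 e2] := (continuous_within_itvP e N11).1 ce.
    by split=> // x; rewrite in_itv/= => /de[].
  by move=> x; rewrite in_itv/= => /de[_]; rewrite derive1E.
exists u; split=> //.
- by move=> k; exact: C1_W12_continuous (cu k) (cv k) (du k).
- move=> w wW wab; rewrite uE; apply/ler_addgt0Pr => eps eps0.
  have wdP k := weak_derivativeP (wW k).1.
  (* Half of [eps], since the sampling error is multiplied by the length 2 of [Omega]. *)
  have eps2 : 0 < eps / 2 by rewrite divr_gt0.
  have := denergy_le_integral al_gt0 f_lip (fun k => (wW k).2)
    (fun k => (wdP k).1) (fun k => (wdP k).2) eps2.
  rewrite divfK//; apply: (emin (fun y k => w k y)); apply/funext => k.
    by case: (wab k).
  by case: (wab k).
- move=> k; have ck : {within Omega R, continuous (fun x => df k (u ^~ x) / al k)}.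
    apply: (within_continuous_loclip (f := fun x => df k x / al k)) => //.
    by apply: loclipM => //; exact: loclip_cst.
  have [C2 uE2] := C2_second_derivative (cu k) ck (fun x => duv k x).
  by split=> // x x1; rewrite uE2// mulrC divfK// gt_eqF.
Qed.

End SmoothMinimiser.
(** * The ferronematic energy *)

Section FerronematicPotential.
Context {R : realType}.
Variables (l1 l2 c xi : R).
Implicit Types (x : bool * bool -> R) (k : bool * bool).

(* The components Q11, Q12, M1, M2 are indexed by
   (true, true), (true, false), (false, true), (false, false). *)
Definition ferro_weight k : R := if k.1 then l1 else xi * l2.

Definition ferro_potential x : R :=
  (x (true, true) ^+ 2 + x (true, false) ^+ 2 - 1) ^+ 2
  + xi / 4 * (x (false, true) ^+ 2 + x (false, false) ^+ 2 - 1) ^+ 2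
  - c * x (true, true) * (x (false, true) ^+ 2 - x (false, false) ^+ 2)
  - 2 * c * x (true, false) * x (false, true) * x (false, false).

(** The partial derivatives of [ferro_potential], written exactly as the right-hand sides of the
    Euler-Lagrange system. *)
Definition ferro_gradient k x : R :=
  match k with
  | (true, true) =>
      4 * x (true, true) * (x (true, true) ^+ 2 + x (true, false) ^+ 2 - 1)
      - c * (x (false, true) ^+ 2 - x (false, false) ^+ 2)
  | (true, false) =>
      4 * x (true, false) * (x (true, true) ^+ 2 + x (true, false) ^+ 2 - 1)
      - 2 * c * x (false, true) * x (false, false)
  | (false, true) =>
      xi * x (false, true) * (x (false, true) ^+ 2 + x (false, false) ^+ 2 - 1)
      - 2 * c * x (true, true) * x (false, true)
      - 2 * c * x (true, false) * x (false, false)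
  | (false, false) =>
      xi * x (false, false) * (x (false, true) ^+ 2 + x (false, false) ^+ 2 - 1)
      + 2 * c * x (true, true) * x (false, false)
      - 2 * c * x (true, false) * x (false, true)
  end.

Hypothesis xi_gt0 : 0 < xi.

Lemma loclip_ferro_potential : loclip ferro_potential.
Proof.
by do ![apply: loclipD | apply: loclipN | apply: loclipM | apply: loclipX
  | exact: loclip_cst | exact: loclip_proj].
Qed.

Lemma loclip_ferro_gradient k : loclip (ferro_gradient k).
Proof.
by move: k => [[] []]; do ![apply: loclipD | apply: loclipN | apply: loclipM
  | apply: loclipX | exact: loclip_cst | exact: loclip_proj].
Qed.

(* Completing squares: with [W = (M1^2 - M2^2, 2 M1 M2)], of norm [|M|^2], the
   coupling [- c Q . W] is absorbed by [xi / 8 * |W - (4 c / xi) Q|^2]. *)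
Lemma ferro_potential_ge x :
  - (xi / 4 + (1 + c ^+ 2 / xi) ^+ 2) <= ferro_potential x.
Proof.
rewrite -subr_ge0 opprK /ferro_potential.
set q1 := x (true, true); set q2 := x (true, false).
set m1 := x (false, true); set m2 := x (false, false).
pose r := 4 * c / xi.
(* Completing the square in [W] leaves [- (2 c^2 / xi) |Q|^2], which moves the centre of the well in
   [|Q|^2] from 1 to [1 + c^2 / xi]. *)
have -> : (q1 ^+ 2 + q2 ^+ 2 - 1) ^+ 2 + xi / 4 * (m1 ^+ 2 + m2 ^+ 2 - 1) ^+ 2
  - c * q1 * (m1 ^+ 2 - m2 ^+ 2) - 2 * c * q2 * m1 * m2
  + (xi / 4 + (1 + c ^+ 2 / xi) ^+ 2) =
  (q1 ^+ 2 + q2 ^+ 2 - (1 + c ^+ 2 / xi)) ^+ 2 + 1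
  + xi / 8 * ((m1 ^+ 2 + m2 ^+ 2 - 2) ^+ 2
    + ((m1 ^+ 2 - m2 ^+ 2 - r * q1) ^+ 2 + (2 * m1 * m2 - r * q2) ^+ 2)).
  by rewrite /r; field; rewrite gt_eqF.
apply: addr_ge0; first by rewrite addr_ge0 ?sqr_ge0.
by apply: mulr_ge0; rewrite ?addr_ge0 ?sqr_ge0// divr_ge0// ltW.
Qed.

(** In the expansion the terms [4 q t^3 + t^4] are at most [(4 |q| + 1) t^2] when [|t| <= 1]; the
    others match exactly. *)
Lemma quartic_increment (q s t : R) : `|t| <= 1 ->
  ((q + t) ^+ 2 + s) ^+ 2 <= (q ^+ 2 + s) ^+ 2 + t * (4 * q * (q ^+ 2 + s))
    + (4 * q ^+ 2 + 2 * (q ^+ 2 + s) + 4 * `|q| + 1) * t ^+ 2.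
Proof.
move=> t1; rewrite -subr_ge0.
have -> : (q ^+ 2 + s) ^+ 2 + t * (4 * q * (q ^+ 2 + s))
    + (4 * q ^+ 2 + 2 * (q ^+ 2 + s) + 4 * `|q| + 1) * t ^+ 2
    - ((q + t) ^+ 2 + s) ^+ 2 =
  t ^+ 2 * (4 * (`|q| - q * t) + (1 - t ^+ 2)) by ring.
rewrite mulr_ge0 ?sqr_ge0// addr_ge0 ?mulr_ge0// subr_ge0.
  rewrite (le_trans (ler_norm _))// normrM -[leRHS]mulr1.
  by rewrite ler_wpM2l.
by rewrite -(real_normK (num_real t)) expr_le1.
Qed.

(** Each coordinate enters one quartic well and the coupling. The coupling is affine in [Q11] and
    [Q12], and quadratic in [M1] and [M2] with coefficients [- c q1] and [c q1], which are added to
    the constant. *)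
Lemma ferro_potential_increment x k : exists C : R, forall t, `|t| <= 1 ->
  ferro_potential (fun j => if j == k then x j + t else x j) <=
  ferro_potential x + t * ferro_gradient k x + C * t ^+ 2.
Proof.
rewrite /ferro_potential.
have x4 : 0 <= xi / 4 by rewrite divr_ge0// ltW.
move: k => [[] []] /=; set q1 := x (true, true); set q2 := x (true, false);
  set m1 := x (false, true); set m2 := x (false, false).
- pose C := 4 * q1 ^+ 2 + 2 * (q1 ^+ 2 + (q2 ^+ 2 - 1)) + 4 * `|q1| + 1.
  exists C => t /(quartic_increment q1 (q2 ^+ 2 - 1)).
  rewrite -/C; lra.
- pose C := 4 * q2 ^+ 2 + 2 * (q2 ^+ 2 + (q1 ^+ 2 - 1)) + 4 * `|q2| + 1.
  exists C => t /(quartic_increment q2 (q1 ^+ 2 - 1)).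
  rewrite -/C; lra.
- pose C := 4 * m1 ^+ 2 + 2 * (m1 ^+ 2 + (m2 ^+ 2 - 1)) + 4 * `|m1| + 1.
  exists (xi / 4 * C - c * q1) => t /(quartic_increment m1 (m2 ^+ 2 - 1)).
  rewrite -/C => /(ler_wpM2l x4); lra.
- pose C := 4 * m2 ^+ 2 + 2 * (m2 ^+ 2 + (m1 ^+ 2 - 1)) + 4 * `|m2| + 1.
  exists (xi / 4 * C + c * q1) => t /(quartic_increment m2 (m1 ^+ 2 - 1)).
  rewrite -/C => /(ler_wpM2l x4); lra.
Qed.

Lemma sum_bool_pair (F : bool * bool -> R) : \sum_k F k =
  F (true, true) + F (true, false) + F (false, true) + F (false, false).
Proof.
rewrite (eq_bigr (fun k => F (k.1, k.2))) => [|[]//].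
by rewrite -(pair_bigA _ (fun i j => F (i, j)))/= !big_bool/= addrA.
Qed.

Lemma energy_path_energy (u : bool * bool -> R -> R) :
  energy l1 l2 c xi (u (true, true)) (u (true, false))
    (u (false, true)) (u (false, false)) =
  path_energy ferro_weight ferro_potential u.
Proof.
apply: eq_Rintegral => y _.
rewrite /density sum_bool_pair /ferro_weight /ferro_potential/=.
by ring.
Qed.

End FerronematicPotential.

Theorem theorem2p1 (R : realType) (l1 l2 c xi : R)
    (hl1 : 0 < l1) (hl2 : 0 < l2) (hc : 0 < c) (hxi : 0 < xi) :
  exists Q11 Q12 M1 M2 : R -> R,
    minimiser l1 l2 c xi Q11 Q12 M1 M2 /\
    classical_solution l1 l2 c xi Q11 Q12 M1 M2.
Proof.
pose al : bool * bool -> R := ferro_weight l1 l2 xi.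
have al_gt0 k : 0 < al k.
  by rewrite /al /ferro_weight; case: ifP => // _; rewrite mulr_gt0.
(* The indices with second component [true] are those of [Q11] and [M1], the components with nonzero
   boundary values. *)
pose a (k : bool * bool) : R := if k.2 then 1 else 0.
pose b (k : bool * bool) : R := if k.2 then -1 else 0.
have [u [uW uab umin uEL]] := smooth_minimiser al_gt0
  (ferro_potential_ge c hxi) (@loclip_ferro_potential _ c xi)
  (@loclip_ferro_gradient _ c xi) (ferro_potential_increment c hxi) a b.
have ubc : boundary_conditions (u (true, true)) (u (true, false))
    (u (false, true)) (u (false, false)).
  have [? ?] := uab (true, true); have [? ?] := uab (true, false).
  have [? ?] := uab (false, true); have [? ?] := uab (false, false).
  by split.
exists (u (true, true)), (u (true, false)).
exists (u (false, true)), (u (false, false)).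
split; first split=> //.
  move=> P11 P12 N1 N2 [P11W P12W N1W N2W [[? ?] [? ?] [? ?] [? ?]]].
  pose w (k : bool * bool) := match k with (true, true) => P11 | (true, false) => P12
    | (false, true) => N1 | (false, false) => N2 end.
  (* The four competitors are refolded as the family [w], so that both energies become path
     energies. *)
  rewrite energy_path_energy -/(energy _ _ _ _ (w (true, true)) (w (true, false))
    (w (false, true)) (w (false, false))) (energy_path_energy _ _ _ _ w).
  by apply: umin => -[[] []].
have EL k y (y1 : -1 < y < 1) := (uEL k).2 y y1.
split=> //; first by split; exact: (uEL _).1.
move=> y y1; split; first exact: (EL (true, true) y y1).
- exact: (EL (true, false) y y1).
- exact: (EL (false, true) y y1).
- exact: (EL (false, false) y y1).
Qed.
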